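(* For every $(\mathbf{x},t)\in\mathbb{R}^n\times[0,T]$, the value function $$V(\mathbf{x},t):=\inf_{u\in\mathcal{U}}\left\{\int_t^T L(s,x(s),u(s))\,ds+g(x(T)) : \dot x(s)=f(s,x(s),u(s)),\ x(t)=\mathbf{x}\right\}$$ can be represented as $$V(\mathbf{x},t)=\inf\left\{\int_t^T H^*(s,x(s),-\dot x(s))\,ds+g(x(T)) : x(t)=\mathbf{x}\right\}$$ $$=\inf\left\{\int_t^T H^*(s,x(s),\beta(s))\,ds+g(x(T)) : x(t)=\mathbf{x},\ \dot x(s)=-\beta(s),\ \beta(s)\in\mathrm{Conv}(B(x(s),s))\right\}.$$ The first infimum on the right is over absolutely continuous curves $x:[t,T]\to\mathbb{R}^n$ (i.e. with $\dot x\in L^1$). The second is over pairs $(x,\beta)$ with $\beta:[t,T]\to\mathbb{R}^n$ measurable and $x$ absolutely continuous, the constraints on $\dot x$ and $\beta$ holding for a.e. $s\in[t,T]$.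
   Context: Fix $T>0$ and a (nonempty) compact control set $U\subset\mathbb{R}^m$; $\mathcal{U}:=\{u:[0,T]\to U : u\text{ is measurable}\}$. Standing assumptions: $f:[0,T]\times\mathbb{R}^n\times U\to\mathbb{R}^n$ and $L:[0,T]\times\mathbb{R}^n\times U\to[0,\infty)$ are such that $f(t,\mathbf{x},a)$ and $L(t,\mathbf{x},a)$ are Lipschitz continuous in $t$ and $\mathbf{x}$ for each $a\in U$; $g:\mathbb{R}^n\to\mathbb{R}$ is Lipschitz continuous and uniformly bounded. The feasible set of negative vector fields is $B(\mathbf{x},t):=\{-f(t,\mathbf{x},a):a\in U\}$, which is compact for every $(\mathbf{x},t)$. $\mathrm{Conv}(A)$ denotes the convex hull of $A$. The Hamiltonian is $H(t,\mathbf{x},p):=\sup_{a\in U}\{-p\cdot f(t,\mathbf{x},a)-L(t,\mathbf{x},a)\}$, and its convex conjugate in the last variable is $H^*(t,\mathbf{x},b):=\sup_{p\in\mathbb{R}^n}\{p\cdot b-H(t,\mathbf{x},p)\}\in(-\infty,+\infty]$.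
   Formalization: The Lipschitz constants of f and L in (t, x) are taken uniform over all a in U; with constants that may depend on a without bound, the claimed equality can fail (the relaxed infimum can be strictly smaller than V). *)

(* Defs.v *)
From HB Require Import structures.
From mathcomp Require Import all_boot all_order all_algebra.
From mathcomp Require Import all_classical all_reals all_analysis.
Import Order.TTheory GRing.Theory Num.Theory.
Import numFieldNormedType.Exports.
Set Implicit Arguments.
Unset Strict Implicit.
Unset Printing Implicit Defensive.
Local Open Scope classical_set_scope.
Local Open Scope ring_scope.

Definition dot (R : realType) (n : nat) (p b : 'rV[R]_n) : R :=
  \sum_(i < n) p 0 i * b 0 i.

(* The constant [k] is uniform in the control [a]: with constants
   depending on [a] and unbounded over [U], the relaxed infimum can be strictly
   smaller than the value function.  The time variable is restricted to [0, T]; the pair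
   [(t, x)] carries the product (max) norm. *)
Definition lipschitz_tx (R : realType) (n m : nat) (W : normedModType R)
    (T : R) (U : set 'rV[R]_m) (h : R -> 'rV[R]_n -> 'rV[R]_m -> W) : Prop :=
  exists k : R, forall a, U a ->
    k.-lipschitz_(`[0, T]%classic `*` [set: 'rV[R]_n])
      (fun z : R * 'rV[R]_n => h z.1 z.2 a).

(* Borel measurability, coordinatewise; up to a modification on a null set
   this is Lebesgue measurability. *)
Definition measurable_curve (R : realType) (d : nat) (D : set R)
    (v : R -> 'rV[R]_d) : Prop :=
  forall i : 'I_d, measurable_fun D (fun s => v s 0 i).

(* Absolute continuity on [a, b] in the W^{1,1} form: [x] is the indefinite
   Lebesgue integral of some [v] in L^1([a, b]; R^n), which is then its a.e.
   derivative.  Values of [x] outside [a, b] are irrelevant. *)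
Definition abs_continuous_curve (R : realType) (n : nat) (a b : R)
    (x : R -> 'rV[R]_n) : Prop :=
  exists v : R -> 'rV[R]_n, forall i : 'I_n,
    (@lebesgue_measure R).-integrable `[a, b] (fun s => (v s 0 i)%:E) /\
    forall s, s \in `[a, b] ->
      x s 0 i = x a 0 i + \int[@lebesgue_measure R]_(r in `[a, s]) v r 0 i.

Definition convex_hull (R : realType) (n : nat) (A : set 'rV[R]_n) :
    set 'rV[R]_n :=
  [set v | exists (k : nat) (w : 'I_k -> R) (y : 'I_k -> 'rV[R]_n),
    [/\ forall j, 0 <= w j, \sum_(j < k) w j = 1, forall j, A (y j)
      & v = \sum_(j < k) w j *: y j]].

Section ControlProblem.
Variables (R : realType) (n m : nat) (T : R) (U : set 'rV[R]_m).
Variables (f : R -> 'rV[R]_n -> 'rV[R]_m -> 'rV[R]_n).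
Variables (L : R -> 'rV[R]_n -> 'rV[R]_m -> R) (g : 'rV[R]_n -> R).

Definition feasible_set (x : 'rV[R]_n) (t : R) : set 'rV[R]_n :=
  [set - f t x a | a in U].

Definition hamiltonian (t : R) (x p : 'rV[R]_n) : \bar R :=
  ereal_sup [set (- dot p (f t x a) - L t x a)%:E | a in U].

Definition hamiltonian_conj (t : R) (x b : 'rV[R]_n) : \bar R :=
  ereal_sup (range (fun p : 'rV[R]_n => (dot p b)%:E - hamiltonian t x p)%E).

Definition controls : set (R -> 'rV[R]_m) :=
  [set u | measurable_curve `[0, T] u /\ forall s, s \in `[0, T] -> U (u s)].

Definition value_function (x0 : 'rV[R]_n) (t : R) : \bar R :=
  ereal_inf [set J : \bar R | exists (u : R -> 'rV[R]_m) (x : R -> 'rV[R]_n),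
    [/\ controls u, abs_continuous_curve t T x, x t = x0,
        {ae @lebesgue_measure R, forall s, s \in `[t, T] ->
           is_derive s 1 x (f s (x s) (u s))}
      & J = (\int[@lebesgue_measure R]_(s in `[t, T]) (L s (x s) (u s))%:E
             + (g (x T))%:E)%E]].

End ControlProblem.

(* Main.v *)
Require Import Defs.
From HB Require Import structures.
From mathcomp Require Import all_boot all_order all_algebra.
From mathcomp Require Import all_classical all_reals all_analysis.
From mathcomp Require Import measurable_realfun.
From mathcomp Require Import ring lra.
Set Implicit Arguments.
Unset Strict Implicit.
Unset Printing Implicit Defensive.
Import Order.TTheory GRing.Theory Num.Theory.
Import numFieldNormedType.Exports.
Local Open Scope classical_set_scope.
Local Open Scope ring_scope.

(** One inequality is immediate: as H^* is the conjugate of H, it satisfies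
    H^*(s, z, - f(s, z, a)) <= L(s, z, a), so a controlled trajectory competes in
    both relaxed problems at no larger cost ([relaxed_cost_le_cost]).

    For the converse, let x be an absolutely continuous curve of finite relaxed
    cost, and cut [t, T] into short blocks of length h.  On block j let b_j be the
    mean of - x' and (t_j, x_j) the left end point.  Over the finite convex
    combinations of controls, with F and G the corresponding means of
    f(t_j, x_j, .) and L(t_j, x_j, .), minimise approximately
    G + (N / 2) |F + b_j|^2.  The first-order condition says that
    p := N (F + b_j) is nearly a subgradient: H(t_j, x_j, p) is at most
    - p . F - G up to a small error.  Testing the supremum that defines H^* with
    this one p bounds H^*(s, x(s), - x'(s)), all along the block, from below by an
    affine function of x'(s) whose mean over the block is at least
    A |F + b_j| + G - 4 e, for a prescribed A ([penalized_subgradient]).  So the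
    convex combinations have total running cost at most the relaxed one, up to O(e),
    and the defects |F + b_j| are penalised by a factor A as large as desired.

    The combinations are then realised by a control that is constant on consecutive
    subintervals of each block ([chattering]), whose trajectory y comes from Picard
    iteration ([picard]).  Gronwall's inequality bounds |y - x| by
    exp(k (T - t)) times the sum of the h |F + b_j|, up to O(h).  The choice
    A := (k (T - t) + k) exp(k (T - t)) is exactly what makes the penalty pay for the
    effect of this deviation on the running cost and on g
    ([near_optimal_control]).

    Since L has no prescribed regularity in the control, s |-> L(s, x(s), u(s)) may
    fail to be measurable, and its integral is then a lower integral, the supremum
    of the integrals of the simple functions below it.  Comparisons with such
    integrals go through the lemmas of the first part. *)

(** * Lower integrals *)

Section LowerIntegral.
Context d (T : measurableType d) (R : realType) (mu : {measure set T -> \bar R}).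
Local Open Scope ereal_scope.
Import HBNNSimple.

Lemma ge0_integral_sup (D : set T) (f : T -> \bar R) :
  (forall x, D x -> 0 <= f x) ->
  \int[mu]_(x in D) f x =
  ereal_sup [set \int[mu]_x (h x)%:E | h in
    [set h : {nnsfun T >-> R} | forall x, (h x)%:E <= (f \_ D) x]].
Proof.
move=> f0; rewrite (ge0_integralE mu f0) /=; congr ereal_sup.
by apply/seteqP; split => _ [h hf <-]; exists h => //; rewrite integralT_nnsfun.
Qed.

(** Monotonicity survives without measurability: a simple function below f,
    cut off on the exceptional null set, lies below g and has the same integral. *)
Lemma ge0_ae_le_integral_lower (D : set T) (f g : T -> \bar R) :
  (forall x, D x -> 0 <= f x) -> (forall x, D x -> 0 <= g x) ->
  {ae mu, forall x, D x -> f x <= g x} ->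
  \int[mu]_(x in D) f x <= \int[mu]_(x in D) g x.
Proof.
move=> f0 g0 [N [mN N0 fgN]].
rewrite !ge0_integral_sup//; apply: ge_ereal_sup => _ [h hf <-].
have mCN : measurable (~` N) by exact: measurableC.
rewrite (_ : \int[mu]_x (h x)%:E = \int[mu]_x (proj_nnsfun h mCN x)%:E).
  apply: ereal_sup_ubound; exists (proj_nnsfun h mCN) => //= x.
  rewrite mindicE; have [xN|xN] := boolP (x \in ~` N); last first.
    by rewrite mulr0 patchE; case: ifPn => // /set_mem; exact: g0.
  rewrite mulr1; apply: (le_trans (hf x)); rewrite !patchE.
  case: ifPn => // /set_mem Dx; apply: contrapT => fg; move/set_mem: xN; apply.
  by apply: fgN => /= /(_ Dx).
apply: ae_eq_integral => //=.
- by apply/measurable_EFinP.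
- by apply/measurable_EFinP; apply: measurable_funM => //; exact: measurable_indic.
exists N; split => // x /= xN; apply: contrapT => Nx; apply: xN => _.
by rewrite mindicE mem_set ?mulr1.
Qed.

(** Lower integrals are only superadditive; this is the direction in which the
    block estimates are added up. *)
Lemma ge0_integral_setU_lower (A B : set T) (f : T -> \bar R) :
  [disjoint A & B] -> (forall x, (A `|` B) x -> 0 <= f x) ->
  \int[mu]_(x in A) f x + \int[mu]_(x in B) f x <=
  \int[mu]_(x in A `|` B) f x.
Proof.
move=> AB0 f0; have fA x : A x -> 0 <= f x by move=> Ax; apply: f0; left.
have fB x : B x -> 0 <= f x by move=> Ax; apply: f0; right.
have sub (C : set T) : C `<=` A `|` B ->
  \int[mu]_(x in C) f x <= \int[mu]_(x in A `|` B) f x.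
  move=> CAB; rewrite !ge0_integral_sup//; last by move=> x /CAB/f0.
  apply: le_ereal_sup => _ [h hf <-]; exists h => //= x.
  apply: le_trans (hf x) _; rewrite !patchE; case: ifPn => [/set_mem Cx|_].
    by rewrite mem_set//; exact: CAB.
  by case: ifPn => // /set_mem /f0.
have [Ioo|] := eqVneq (\int[mu]_(x in A `|` B) f x) +oo; first by rewrite Ioo leey.
rewrite -ltey => Ioo.
have finI (C : set T) : C `<=` A `|` B -> \int[mu]_(x in C) f x \is a fin_num.
  move=> CAB; rewrite ge0_fin_numE; first exact: le_lt_trans (sub _ CAB) Ioo.
  by apply: integral_ge0 => x /CAB/f0.
rewrite -leeBrDr; last by apply: finI; right.
rewrite {1}ge0_integral_sup//; apply: ge_ereal_sup => _ [h1 h1f <-].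
have h1fin : \int[mu]_x (h1 x)%:E \is a fin_num.
  rewrite ge0_fin_numE ?integral_ge0//; last by move=> x _; rewrite lee_fin.
  apply: le_lt_trans Ioo; apply: le_trans (sub A _); last by move=> x; left.
  by rewrite [leRHS]ge0_integral_sup//; apply: ereal_sup_ubound; exists h1.
rewrite leeBrDr; last by apply: finI; right.
rewrite addeC -leeBrDr// {1}ge0_integral_sup//.
apply: ge_ereal_sup => _ [h2 h2f <-].
rewrite leeBrDr// [leRHS]ge0_integral_sup//; apply: ereal_sup_ubound.
exists (add_nnsfun h1 h2); last first.
  by rewrite (integralT_nnsfun mu (add_nnsfun h1 h2)) sintegralD !integralT_nnsfun addeC.
move=> x /=; have := h1f x; have := h2f x; rewrite !patchE EFinD in_setU.
have : ~ (A x /\ B x).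
  by move=> ABx; move: AB0 => /disj_setPLR /(_ x ABx.1); apply; exact: ABx.2.
case: ifPn => [/set_mem Bx|_]; case: ifPn => [/set_mem Ax|_] /=.
- by move=> /(_ (conj Ax Bx)).
- by move=> _ h2x h1x; rewrite -[leRHS]add0e leeD.
- by move=> _ h2x h1x; rewrite -[leRHS]adde0 leeD.
- by move=> _ h2x h1x; rewrite -[leRHS]adde0 leeD.
Qed.

End LowerIntegral.

Local Notation mu := (@lebesgue_measure _).

(** * Absolutely continuous curves *)

(** The L^1 function that [abs_continuous_curve] asserts to exist, made explicit. *)
Definition density (R : realType) (n : nat) (a b : R)
    (x v : R -> 'rV[R]_n) : Prop :=
  forall i : 'I_n,
    mu.-integrable `[a, b] (fun s => (v s 0 i)%:E) /\
    forall s, s \in `[a, b] ->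
      x s 0 i = x a 0 i + \int[mu]_(r in `[a, s]) v r 0 i.

Lemma rV_norm_leP (R : realType) n (x : 'rV[R]_n) (e : R) : 0 <= e ->
  reflect (forall i, `|x 0 i| <= e) (`|x| <= e).
Proof.
move=> e0; rewrite [X in X <= _]/Num.Def.normr/= mx_normrE.
apply: (iffP idP) => [xe i|xe].
  by apply: le_trans xe; exact: (le_bigmax _ (fun ij => `|x ij.1 ij.2|) (0, i)).
by apply: bigmax_le => // -[j i] _; rewrite (ord1 j) /=.
Qed.

Lemma rV_coord_le_norm (R : realType) n (x : 'rV[R]_n) i : `|x 0 i| <= `|x|.
Proof. exact/rV_norm_leP. Qed.

Lemma is_derive_rV (R : realType) n (x : R -> 'rV[R]_n) (s : R) (v : 'rV[R]_n) :
  (forall i, is_derive s 1 (fun r => x r 0 i) (v 0 i)) -> is_derive s 1 x v.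
Proof.
move=> dx; have dxs : derivable x s 1.
  by apply/derivable_mxP => j i; rewrite (ord1 j); have [] := dx i.
apply: DeriveDef => //; rewrite derive_mx//; apply/rowP => i; rewrite mxE.
by have [_ ->] := dx i.
Qed.

Lemma aeS (R : realType) (P Q : R -> Prop) : (forall s, P s -> Q s) ->
  {ae mu, forall s, P s} -> {ae mu, forall s, Q s}.
Proof. by move=> PQ; apply: filterS => //; exact: (ae_filter_ringOfSetsType mu). Qed.

Lemma aeI (R : realType) (P Q : R -> Prop) :
  {ae mu, forall s, P s} -> {ae mu, forall s, Q s} ->
  {ae mu, forall s, P s /\ Q s}.
Proof. by move=> ? ?; apply: filterI => //; exact: (ae_filter_ringOfSetsType mu). Qed.

Lemma ae_all_ord (R : realType) n (P : 'I_n -> R -> Prop) :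
  (forall i, {ae mu, forall s, P i s}) ->
  {ae mu, forall s, forall i, P i s}.
Proof.
by move=> P_ae; apply: filter_forall => //; exact: (ae_filter_ringOfSetsType mu).
Qed.

Lemma ae_neq (R : realType) (a : R) : {ae mu, forall s, s != a}.
Proof.
exists [set a]; split; [exact: measurable_set1|exact: lebesgue_measure_set1|].
by move=> s /= /negP; rewrite negbK => /eqP.
Qed.

(** Lebesgue's differentiation theorem, in the form that fits
    [abs_continuous_curve]: only the integrability on the interval is at hand, so v
    is extended by 0. *)
Lemma is_derive_indefinite_integral (R : realType) (a b : R) (v : R -> R) :
  mu.-integrable `[a, b] (EFin \o v) ->
  {ae mu, forall s, s \in `]a, b[ ->
    is_derive s 1 (fun r => \int[mu]_(t in `[a, r]) v t) (v s)}.
Proof.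
move=> iv.
have locv := integrable_locally (measurable_itv `[a, b]) iv.
have iv' : mu.-integrable setT (EFin \o (v \_ `[a, b])).
  by move/integrable_mkcond: iv; rewrite restrict_EFin; apply.
have := @FTC1 R (v \_ `[a, b]) (BLeft a) _ locv.
have iva y : mu.-integrable [set` Interval (BLeft a) (BRight y)]
    (EFin \o (v \_ `[a, b])) by exact: integrableS iv'.
move=> /(_ iva); apply: aeS => s Fs; rewrite in_itv /= => /andP[sa sb].
have [|dF Fv] := Fs; first by rewrite /= lte_fin.
have sab : s \in `[a, b]%classic by rewrite inE /= in_itv /= !ltW.
move: Fv; rewrite derive1E patchE sab => Fv.
suff : is_derive s 1 (fun r => \int[mu]_(t in `[a, r]) (v \_ `[a, b]) t) (v s).
  apply: near_eq_is_derive; near=> r; apply: eq_Rintegral => t.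
  rewrite inE /= in_itv /= => /andP[ta tr]; rewrite patchE mem_set//= in_itv /= ta /=.
  apply: (le_trans tr); near: r; exact: lt_le_nbhsl.
exact: DeriveDef.
Unshelve. all: by end_near. Qed.

Lemma density_is_derive (R : realType) n (a b : R) (x v : R -> 'rV[R]_n) :
  density a b x v ->
  {ae mu, forall s, s \in `[a, b] -> is_derive s 1 x (v s)}.
Proof.
move=> xv.
have : {ae mu, forall s, forall i, s \in `]a, b[ ->
    is_derive s 1 (fun r => \int[mu]_(t in `[a, r]) v t 0 i) (v s 0 i)}.
  by apply: ae_all_ord => i; apply: is_derive_indefinite_integral; have [] := xv i.
move=> /aeI/(_ (ae_neq a))/aeI/(_ (ae_neq b)); apply: aeS => s [[ds sa] sb] sab.
apply: is_derive_rV => i.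
have {}sab : s \in `]a, b[.
  by move: sab; rewrite !in_itv /= !lt_neqAle sb eq_sym sa.
have := ds i sab => {}ds.
have : is_derive s 1 (fun r => x a 0 i + \int[mu]_(t in `[a, r]) v t 0 i) (v s 0 i).
  by rewrite -[v s 0 i]add0r; apply: is_deriveD.
apply: near_eq_is_derive; near=> r; apply/esym/(xv i).2.
have rab : r \in `]a, b[ by near: r; exact: near_in_itvoo.
by move: rab; rewrite !in_itv /= => /andP[/ltW ar /ltW rb]; rewrite ar rb.
Unshelve. all: by end_near. Qed.

Lemma density_incr (R : realType) n (a b : R) (x v : R -> 'rV[R]_n) :
  density a b x v -> forall s s', a <= s -> s <= s' -> s' <= b -> forall i,
  x s' 0 i - x s 0 i = \int[mu]_(r in `]s, s']) v r 0 i.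
Proof.
move=> xv s s' sa ss' s'b i; have [iv xi] := xv i.
have sab : s \in `[a, b] by rewrite in_itv /= sa (le_trans ss').
have s'ab : s' \in `[a, b] by rewrite in_itv /= (le_trans sa).
rewrite (xi s')// (xi s)//.
rewrite opprD addrACA subrr add0r Rintegral_itvB ?bnd_simp//.
by apply: integrableS iv => //; exact: subset_itvl.
Qed.

Lemma density_unif_continuous (R : realType) n (a b : R) (x v : R -> 'rV[R]_n) :
  density a b x v -> forall e, 0 < e -> exists2 d, 0 < d &
  forall s s', a <= s -> s <= s' -> s' <= b -> s' - s < d -> `|x s' - x s| <= e.
Proof.
move=> xv e e0.
have /choice[d dP] i : exists d, 0 < d /\ forall s s', a <= s -> s <= s' -> s' <= b ->
    s' - s < d -> `|x s' 0 i - x s 0 i| <= e.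
  have [iv _] := xv i.
  have iv' : mu.-integrable setT (EFin \o ((fun r => v r 0 i) \_ `[a, b])).
    by rewrite -restrict_EFin; apply/integrable_restrict => //=; rewrite setTI.
  have [d [d0 dP]] := integral_normr_continuous iv' e0.
  exists d; split => // s s' sa ss' s'b s'sd; rewrite (density_incr xv)//.
  have sub : `]s, s']%classic `<=` `[a, b]%classic.
    by apply: (@subset_trans _ `[s, s']); [exact: subset_itv_oc_cc|exact: subset_itvScc].
  apply: (le_trans (le_normr_Rintegral _ _)) => //; first exact: integrableS iv.
  rewrite -(setIidl sub) Rintegral_mkcondr/=.
  under eq_Rintegral do rewrite restrict_normr.
  apply/ltW/dP => //; have := lebesgue_measure_itv `]s, s'] => /= ->.
  by case: ifP => // _; rewrite -EFinD lte_fin.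
exists (\big[Order.min/1]_i d i).
  by apply: lt_bigmin => // i _; have [] := dP i.
move=> s s' sa ss' s'b s'sd; apply/rV_norm_leP => [|i]; first exact: ltW.
rewrite !mxE; have [_] := dP i; apply => //; apply: (lt_le_trans s'sd).
exact: bigmin_le.
Qed.

(** * Convex combinations and approximate first-order conditions *)

Section Dot.
Context (R : realType) (n : nat).
Implicit Types p q b : 'rV[R]_n.

Lemma dotDr p b c : dot p (b + c) = dot p b + dot p c.
Proof. by rewrite /dot -big_split; apply: eq_bigr => i _; rewrite mxE mulrDr. Qed.

Lemma dotDl p q b : dot (p + q) b = dot p b + dot q b.
Proof. by rewrite /dot -big_split; apply: eq_bigr => i _; rewrite mxE mulrDl. Qed.

Lemma dotZr c p b : dot p (c *: b) = c * dot p b.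
Proof. by rewrite /dot mulr_sumr; apply: eq_bigr => i _; rewrite mxE mulrCA. Qed.

Lemma dotZl c p b : dot (c *: p) b = c * dot p b.
Proof. by rewrite /dot mulr_sumr; apply: eq_bigr => i _; rewrite mxE mulrA. Qed.

Lemma dotNr p b : dot p (- b) = - dot p b.
Proof. by rewrite -scaleN1r dotZr mulN1r. Qed.

Lemma dot0l b : dot 0 b = 0.
Proof. by rewrite -(scale0r 0) dotZl mul0r. Qed.

Lemma dotC p q : dot p q = dot q p.
Proof. by apply: eq_bigr => i _; rewrite mulrC. Qed.

Lemma dot_ge0 p : 0 <= dot p p.
Proof. by apply: sumr_ge0 => i _; rewrite -expr2 sqr_ge0. Qed.

Lemma norm_dot_le p b : `|dot p b| <= n%:R * `|p| * `|b|.
Proof.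
have -> : n%:R * `|p| * `|b| = \sum_(i < n) `|p| * `|b|.
  by rewrite sumr_const card_ord -mulrA mulr_natl.
apply: le_trans (ler_norm_sum _ _ _) _; apply: ler_sum => i _.
by rewrite normrM ler_pM// rV_coord_le_norm.
Qed.

Lemma sqr_norm_le_dot p : `|p| ^+ 2 <= dot p p.
Proof.
rewrite -ler_sqrt ?dot_ge0// sqrtr_sqr normr_id.
apply/rV_norm_leP => [|i]; first exact: sqrtr_ge0.
rewrite -sqrtr_sqr ler_sqrt ?dot_ge0// /dot (bigD1 i)//= expr2 lerDl.
by apply: sumr_ge0 => j _; rewrite -expr2 sqr_ge0.
Qed.

End Dot.

Section ConvexCombinations.
Context (R : realType) (A : eqType) (U : set A).
Implicit Types (l : seq (R * A)).

Definition convex_weights l :=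
  (forall wa, wa \in l -> 0 <= wa.1 /\ U wa.2) /\ \sum_(wa <- l) wa.1 = 1.

Definition mean (V : lmodType R) (phi : A -> V) l : V :=
  \sum_(wa <- l) wa.1 *: phi wa.2.

Lemma convex_weights1 a : U a -> convex_weights [:: (1, a)].
Proof.
by move=> Ua; split; [move=> wa; rewrite inE => /eqP->|rewrite big_seq1].
Qed.

(** The displacement of the combination l by a fraction c towards the single
    point a; it provides the directional derivatives in the minimisation below. *)
Definition tilt (c : R) a l := (c, a) :: [seq ((1 - c) * wa.1, wa.2) | wa <- l].

Lemma convex_weights_tilt c a l : 0 <= c <= 1 -> U a -> convex_weights l ->
  convex_weights (tilt c a l).
Proof.
move=> /andP[c0 c1] Ua [l0 l1]; split.
  move=> wa; rewrite inE => /orP[/eqP-> //|/mapP[wb /l0[w0 Uw] ->]] /=.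
  by split => //; rewrite mulr_ge0// subr_ge0.
by rewrite big_cons big_map /= -mulr_sumr l1 mulr1 addrC subrK.
Qed.

Lemma mean_tilt (V : lmodType R) (phi : A -> V) c a l :
  mean phi (tilt c a l) = mean phi l + c *: (phi a - mean phi l).
Proof.
rewrite /mean big_cons big_map /=.
under eq_bigr do rewrite -scalerA.
by rewrite -scaler_sumr scalerBl scale1r scalerBr addrCA.
Qed.

Lemma mean_norm_le (V : normedModType R) (phi : A -> V) (M : R) l :
  convex_weights l -> (forall a, U a -> `|phi a| <= M) -> `|mean phi l| <= M.
Proof.
move=> [l0 l1] phiM; rewrite -[M]mul1r -l1 mulr_suml /mean.
apply: le_trans (ler_norm_sum _ _ _) _; rewrite big_seq [leRHS]big_seq.
apply: ler_sum => wa /l0[w0 Uw]; rewrite normrZ (ger0_norm w0).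
by rewrite ler_wpM2l ?phiM.
Qed.

Lemma mean_ge0 (phi : A -> R^o) l :
  convex_weights l -> (forall a, U a -> 0 <= phi a) -> 0 <= mean phi l.
Proof.
move=> [l0 l1] phi0; rewrite /mean big_seq; apply: sumr_ge0 => wa /l0[w0 Uw].
by rewrite mulr_ge0 ?phi0.
Qed.

(** An approximate minimiser l of the mean of C plus (N / 2) |mean F + b|^2
    satisfies the first-order condition at the gradient N (mean F + b) of the
    penalty.  Tilting l towards a changes only the quadratic term to second order,
    and that change is controlled by the bound on F; C may be unbounded over U. *)
Lemma approx_dual_combination (n : nat) (F : A -> 'rV[R]_n) (C : A -> R^o)
    (M N e : R) (b : 'rV[R]_n) :
  U !=set0 -> (forall a, U a -> `|F a| <= M) -> (forall a, U a -> 0 <= C a) ->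
  0 < N -> 0 < e ->
  exists2 l, convex_weights l & forall a, U a ->
    - dot (N *: (mean F l + b)) (F a) - C a <=
    - dot (N *: (mean F l + b)) (mean F l) - mean C l + e.
Proof.
move=> [a0 Ua0] FM C0 N0 e0.
pose Phi l := mean C l + N / 2 * dot (mean F l + b) (mean F l + b).
pose S := [set Phi l | l in convex_weights].
have S0 : S !=set0 by exists (Phi [:: (1, a0)]), [:: (1, a0)] => //; exact: convex_weights1.
have lbS : has_lbound S.
  exists 0 => _ [l wl <-]; rewrite addr_ge0 ?mean_ge0// mulr_ge0 ?dot_ge0//.
  by rewrite divr_ge0// ltW.
have M0 : 0 <= M by apply: le_trans (FM _ Ua0).
pose D := n%:R * (M + M) * (M + M).
have D0 : 0 <= D by rewrite !mulr_ge0// addr_ge0.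
(* The step is short enough for the quadratic term to cost at most c e / 2. *)
pose c := Num.min 1 (e / (N * (D + 1))).
have c0 : 0 < c by rewrite lt_min ltr01 divr_gt0// mulr_gt0// ltr_wpDl.
have c1 : c <= 1 by rewrite ge_min lexx.
have cD : c * (N * D) <= e.
  apply: (@le_trans _ _ (c * (N * (D + 1)))).
    by rewrite ler_pM2l// ler_pM2l// lerDl.
  by rewrite -ler_pdivlMr ?mulr_gt0 ?ltr_wpDl// ge_min lexx orbT.
have ce2 : 0 < c * e / 2 by rewrite divr_gt0// mulr_gt0.
have [_ [l wl <-] Phil] := inf_adherent ce2 (conj S0 lbS).
exists l => // a Ua.
have : Phi l < Phi (tilt c a l) + c * e / 2.
  apply: lt_le_trans Phil _; rewrite lerD2r; apply: ge_inf => //.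
  by exists (tilt c a l) => //; apply: convex_weights_tilt => //; rewrite ltW.
rewrite /Phi !mean_tilt; set Fl := mean F l; set Cl := mean C l.
rewrite !dotZl (addrAC Fl _ b); move: (Fl + b) => r.
have [G GE] : exists G, G = F a - Fl by exists (F a - Fl).
rewrite -GE.
have -> : dot (r + c *: G) (r + c *: G) =
    dot r r + 2 * c * dot r G + c * (c * dot G G).
  by rewrite !(dotDl, dotDr, dotZl, dotZr) (dotC G r); ring.
have dG : dot r G = dot r (F a) - dot r Fl by rewrite GE dotDr dotNr.
have GD : dot G G <= D.
  apply: le_trans (ler_norm _) _; apply: le_trans (norm_dot_le _ _) _.
  have GM : `|G| <= M + M.
    by rewrite GE; apply: le_trans (ler_normB _ _) _; rewrite lerD ?FM// mean_norm_le.
  by rewrite ler_pM ?mulr_ge0// ler_wpM2l.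
have : c * (N * dot G G) <= e.
  by apply: le_trans cD; rewrite ler_pM2l// ler_pM2l.
have -> : c *: (C a - Cl) = c * (C a - Cl) by [].
move: (dot G G) (dot r r) dG c0 => g rr -> c0 ge.
have -> : Cl + c * (C a - Cl) + N / 2 * (rr + 2 * c * (dot r (F a) - dot r Fl) + c * (c * g)) + c * e / 2
  = (Cl + N / 2 * rr) + c * (C a - Cl + N * (dot r (F a) - dot r Fl) + c * (N * g) / 2 + e / 2).
  by field.
rewrite ltrDl pmulr_rgt0// => H.
have : N * (dot r (F a) - dot r Fl) = N * dot r (F a) - N * dot r Fl by rewrite mulrBr.
lra.
Qed.

End ConvexCombinations.

(** * The Hamiltonian and its conjugate *)

Section Hamiltonian.
Context (R : realType) (n m : nat) (T : R) (U : set 'rV[R]_m).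
Context (f : R -> 'rV[R]_n -> 'rV[R]_m -> 'rV[R]_n).
Context (L : R -> 'rV[R]_n -> 'rV[R]_m -> R).

(** The Lipschitz condition as it is used: a single tolerance d for time and state,
    and a constant that may be enlarged freely so as to serve f, L and g at once. *)
Definition uniformly_lipschitz (W : normedModType R) (k : R)
    (h : R -> 'rV[R]_n -> 'rV[R]_m -> W) : Prop :=
  forall a s s' z z' d, U a -> s \in `[0, T] -> s' \in `[0, T] ->
    `|s - s'| <= d -> `|z - z'| <= d -> `|h s z a - h s' z' a| <= k * d.

Lemma lipschitz_tx_uniformly (W : normedModType R)
    (h : R -> 'rV[R]_n -> 'rV[R]_m -> W) :
  lipschitz_tx T U h ->
  exists2 k0, 0 <= k0 & forall k, k0 <= k -> uniformly_lipschitz k h.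
Proof.
move=> [k0 hk0]; exists `|k0| => // k k0k a s s' z z' d Ua sT s'T sd zd.
apply: (@le_trans _ _ (k0 * `|(s, z) - (s', z')|)).
  apply: (hk0 a Ua ((s, z), (s', z'))); split; split => //=.
have d0 : 0 <= d by apply: le_trans sd.
apply: (@le_trans _ _ (`|k0| * `|(s, z) - (s', z')|)).
  by rewrite ler_wpM2r// ler_norm.
by rewrite ler_pM// prod_normE/= ge_max sd zd.
Qed.

Lemma hamiltonian_conj_ge t z p b X :
  (forall a, U a -> - dot p (f t z a) - L t z a <= X) ->
  ((dot p b - X)%:E <= hamiltonian_conj U f L t z b)%E.
Proof.
move=> HX; apply: (@le_trans _ _ ((dot p b)%:E - hamiltonian U f L t z p)%E).
  rewrite EFinB leeB//; apply: ge_ereal_sup => _ [a Ua <-].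
  by rewrite lee_fin HX.
by apply: ereal_sup_ubound; exists p.
Qed.

Lemma hamiltonian_conj_ge0 t z b :
  (forall a, U a -> 0 <= L t z a) -> (0 <= hamiltonian_conj U f L t z b)%E.
Proof.
move=> L0; have := @hamiltonian_conj_ge t z 0 b 0.
rewrite dot0l subr0; apply => a Ua; by rewrite dot0l oppr0 sub0r oppr_le0 L0.
Qed.

(** Fenchel's inequality on the graph of the control system. *)
Lemma hamiltonian_conj_le_cost t z a : U a ->
  (hamiltonian_conj U f L t z (- f t z a) <= (L t z a)%:E)%E.
Proof.
move=> Ua; apply: ge_ereal_sup => _ [p _ <-].
have : ((- dot p (f t z a) - L t z a)%:E <= hamiltonian U f L t z p)%E.
  by apply: ereal_sup_ubound; exists a.
rewrite dotNr; case: (hamiltonian U f L t z p) => [r| |] //=.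
  by rewrite !lee_fin; lra.
by rewrite leNye.
Qed.

(** With N := 2 A^2 / e and q := |mean f + b|, the first-order condition of
    [approx_dual_combination] leaves N q^2 - n N q k d, where the second term pays for
    moving from (t0, z0) to (t, z).  The choice of d makes A n k d at most e, so that
    this term is at most 2 A q, while N q^2 = 2 (A q)^2 / e >= 3 A q - 2 e. *)
Lemma penalized_subgradient (k A e : R) : 0 < k -> 0 < A -> 0 < e ->
  U !=set0 -> uniformly_lipschitz k f -> uniformly_lipschitz (W := R) k L ->
  exists2 d, 0 < d & forall M t0 z0 b, t0 \in `[0, T] ->
    (forall a, U a -> `|f t0 z0 a| <= M) -> (forall a, U a -> 0 <= L t0 z0 a) ->
    exists l p, convex_weights U l /\
      forall t z w, t \in `[0, T] -> `|t - t0| <= d -> `|z - z0| <= d ->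
      ((dot p (w - b) + A * `|mean (f t0 z0) l + b|
        + mean (V := R^o) (L t0 z0) l - 4 * e)%:E
        <= hamiltonian_conj U f L t z w)%E.
Proof.
move=> k0 A0 e0 U0 kf kL.
pose c := 1 + n%:R * A; have c1 : 1 <= c by rewrite lerDl mulr_ge0// ltW.
have c0 : 0 < c by apply: lt_le_trans c1.
exists (e / (k * c)); first by rewrite divr_gt0// mulr_gt0.
move=> M t0 z0 b t0T fM L0.
pose N := 2 * A ^+ 2 / e.
have N0 : 0 < N by rewrite divr_gt0// mulr_gt0// exprn_gt0.
have [l wl lP] := approx_dual_combination (C := L t0 z0) b U0 fM L0 N0 e0.
set q := mean (f t0 z0) l + b in lP *.
exists l, (N *: q); split => // t z w tT td zd.
set d := e / (k * c) in td zd.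
have d0 : 0 <= d by rewrite ltW// divr_gt0// mulr_gt0.
set X := - dot (N *: q) (mean (f t0 z0) l) - mean (V := R^o) (L t0 z0) l + e in lP.
pose Y := X + k * d + n%:R * `|N *: q| * (k * d).
apply: le_trans (@hamiltonian_conj_ge t z (N *: q) w Y _); last first.
  move=> a Ua; have := lP a Ua; rewrite -/X => Xa.
  have := kL a t t0 z z0 d Ua tT t0T td zd; rewrite ler_norml => /andP[La _].
  have : `|dot (N *: q) (f t z a - f t0 z0 a)| <= n%:R * `|N *: q| * (k * d).
    by apply: le_trans (norm_dot_le _ _) _; rewrite ler_wpM2l ?mulr_ge0// kf.
  rewrite dotDr dotNr ler_norml => /andP[fa _]; rewrite /Y.
  move: La fa Xa; lra.
rewrite lee_fin /Y /X.
have kd : k * d = e / c by rewrite /d; field; rewrite !gt_eqF.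
have kde : k * d <= e by rewrite kd ler_pdivrMr// ler_peMr// ltW.
have Nkd : A * n%:R * (k * d) <= e.
  by rewrite kd mulrCA ger_pMr// ler_pdivrMr// mul1r /c mulrC lerDr.
have qq := sqr_norm_le_dot q.
have -> : dot (N *: q) (w - b) = dot (N *: q) w + dot (N *: q) (mean (f t0 z0) l) - N * dot q q.
  rewrite -(dotZl N q q) {4}/q; rewrite !dotDr dotNr; ring.
rewrite normrZ (gtr0_norm N0).
have : N * `|q| ^+ 2 <= N * dot q q by rewrite ler_pM2l.
have -> : n%:R * (N * `|q|) * (k * d) = 2 * (A * `|q|) * (A * n%:R * (k * d)) / e.
  by rewrite /N; field; rewrite gt_eqF.
have -> : N * `|q| ^+ 2 = 2 * (A * `|q|) ^+ 2 / e by rewrite /N; field; rewrite gt_eqF.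
have Aq : 0 <= A * `|q| by rewrite mulr_ge0// ltW.
move: (A * `|q|) (A * n%:R * (k * d)) Aq Nkd kde => Q v Q0 ve kde qq'.
have : 2 * Q * v / e <= 2 * Q.
  by rewrite ler_pdivrMr// ler_wpM2l// mulr_ge0.
have : 3 * Q - 9/8 * e <= 2 * Q ^+ 2 / e.
  (* This is 2 (Q - 3 e / 4)^2 >= 0, divided by e. *)
  rewrite ler_pdivlMr//; have := sqr_ge0 (Q - 3/4 * e); rewrite !expr2; nra.
move: kde qq' e0.
move: (2 * Q ^+ 2 / e) (2 * Q * v / e) (N * dot q q) (k * d) => a1 a2 a3 a4.
set a5 := dot _ w; set a6 := dot _ (mean _ _); set a7 := mean (L t0 z0) l.
move: a5 a6 (a7 : R) => {}a5 {}a6 {}a7.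
clear; lra.
Qed.

End Hamiltonian.

(** * Step controls and chattering *)

Section StepControls.
Context (R : realType) (m : nat) (U : set 'rV[R]_m).

(** Controls built from constants by finitely many changes at a time.  Every
    superposition with such a control is measurable whatever its regularity in the
    control variable, by induction over this description. *)
Inductive step_control : (R -> 'rV[R]_m) -> Prop :=
| step_cst a of U a : step_control (fun=> a)
| step_glue (c : R) u1 u2 of step_control u1 & step_control u2 :
    step_control (fun s => if s <= c then u1 s else u2 s).

Lemma step_control_in u : step_control u -> forall s, U (u s).
Proof. by elim=> // c u1 u2 _ IH1 _ IH2 s; case: ifP. Qed.

Lemma step_control_measurable u (phi : R -> 'rV[R]_m -> R) : step_control u ->
  (forall a, U a -> measurable_fun setT (phi ^~ a)) ->
  measurable_fun setT (fun s => phi s (u s)).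
Proof.
move=> su mphi; elim: su => [a Ua|c u1 u2 _ IH1 _ IH2]; first exact: mphi.
rewrite (_ : (fun s => _) =
    fun s => if s <= c then phi s (u1 s) else phi s (u2 s)); last first.
  by apply/funext => s; case: ifP.
by apply: measurable_fun_ifT => //; exact: measurable_fun_ler.
Qed.

Lemma step_control_bounded u (phi : 'rV[R]_m -> R) : step_control u ->
  exists B, forall s, `|phi (u s)| <= B.
Proof.
elim=> [a Ua|c u1 u2 _ [B1 IH1] _ [B2 IH2]]; first by exists `|phi a|.
by exists (Num.max B1 B2) => s; case: ifP => _; rewrite le_max ?IH1 ?IH2 ?orbT.
Qed.

Lemma bounded_itv_integrable (g : R -> R) (B a b : R) (D : interval R) :
  measurable_fun [set` D] g -> (forall s, s \in D -> `|g s| <= B) ->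
  [set` D] `<=` `[a, b]%classic ->
  mu.-integrable [set` D] (EFin \o g).
Proof.
move=> mg gB Dab; apply: measurable_bounded_integrable => //=.
  apply: (@le_lt_trans _ _ (lebesgue_measure `[a, b]%classic)).
    by apply: le_measure; rewrite ?inE.
  have := lebesgue_measure_itv `[a, b] => /= ->; case: ifP => // _.
  by rewrite -EFinD ltry.
exists B; split; first exact: num_real.
by move=> M BM s sD; apply: (le_trans _ (ltW BM)); exact: gB.
Qed.

(** Spending time w on control a, for the entries (w, a) of l in succession, turns
    time integrals of functions of the control into weighted sums.  The same u serves
    every phi, hence all components of f and L simultaneously. *)
Lemma chattering l (c : R) : U !=set0 ->
  (forall wa, wa \in l -> 0 <= wa.1 /\ U wa.2) ->
  exists2 u, step_control u & forall phi : 'rV[R]_m -> R,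
    \int[mu]_(s in `]c, c + \sum_(wa <- l) wa.1]) phi (u s) =
    \sum_(wa <- l) wa.1 * phi wa.2.
Proof.
move=> [a0 Ua0]; elim: l c => [|[w a] l IH] c lP.
  exists (fun=> a0) => [|phi]; first exact: step_cst.
  by rewrite !big_nil addr0 set_itvoc0 Rintegral_set0.
have [//= w0 Ua] := lP (w, a) (mem_head _ _).
have lP' wa : wa \in l -> 0 <= wa.1 /\ U wa.2 by move=> wal; apply: lP; rewrite inE wal orbT.
have [u' su' u'P] := IH (c + w) lP'.
pose u s := if s <= c + w then a else u' s.
have su : step_control u by apply: (step_glue (c + w)) su'; exact: step_cst.
exists u => // phi; rewrite !big_cons /=.
set W := \sum_(wa <- l) wa.1 in u'P *.
have W0 : 0 <= W by rewrite /W big_seq; apply: sumr_ge0 => wa /lP'[].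
rewrite addrA (@itv_bndbnd_setU _ _ _ (BRight (c + w))) ?bnd_simp ?lerDl//.
rewrite Rintegral_setU//; first last.
- apply/disj_setPLR => s /=; rewrite !in_itv /= => /andP[_ sw] /andP[].
  by rewrite ltNge sw.
- rewrite -itv_bndbnd_setU ?bnd_simp ?lerDl//.
  have [B uB] := step_control_bounded phi su.
  apply: (@bounded_itv_integrable _ B c (c + w + W)) => //.
    by apply: measurable_funTS; apply: (step_control_measurable (phi := fun=> phi)) su _.
  exact: subset_itv_oc_cc.
congr (_ + _).
  transitivity (\int[mu]_(s in `]c, c + w]) (phi a)).
    by apply: eq_Rintegral => s; rewrite inE /= in_itv /= /u => /andP[_ ->].
  rewrite Rintegral_cst//.
  have := lebesgue_measure_itv `]c, c + w] => /= ->; rewrite lte_fin ltrDl.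
  have [_|w_le0] := ltP 0 w; first by rewrite -EFinB /= addrAC subrr add0r mulrC.
  by rewrite mulr0 (@le_anti _ _ w 0) ?mul0r// w0 w_le0.
rewrite -u'P; apply: eq_Rintegral => s; rewrite inE /= in_itv /= /u => /andP[ws _].
by rewrite leNgt ws.
Qed.

End StepControls.

(** * Existence of trajectories by Picard iteration *)

Lemma norm_Rintegral_le (R : realType) (D : set R) (g h : R -> R) :
  measurable D -> mu.-integrable D (EFin \o g) -> mu.-integrable D (EFin \o h) ->
  (forall s, D s -> `|g s| <= h s) ->
  `|\int[mu]_(s in D) g s| <= \int[mu]_(s in D) h s.
Proof.
move=> mD ig ih gh; apply: (le_trans (le_normr_Rintegral _ _)) => //.
by apply: le_Rintegral => //; exact: (integrable_norm ig).
Qed.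

Lemma Rintegral_cst_itv (R : realType) (c a b : R) : a <= b ->
  \int[mu]_(s in `]a, b]) c = c * (b - a).
Proof.
move=> ab; rewrite Rintegral_cst//.
have := lebesgue_measure_itv `]a, b] => /= ->; rewrite lte_fin.
have [//|ba] := ltP a b; by rewrite (@le_anti _ _ a b) ?subrr// ab ba.
Qed.

Lemma integrable_cst_itv (R : realType) (c a b : R) (D : interval R) :
  [set` D] `<=` `[a, b]%classic ->
  mu.-integrable [set` D] (EFin \o fun=> c).
Proof. by move=> Dab; apply: (@bounded_itv_integrable _ _ `|c|) Dab. Qed.

Lemma density_lipschitz (R : realType) n (a b B : R) (x v : R -> 'rV[R]_n) :
  density a b x v -> (forall s, s \in `[a, b] -> `|v s| <= B) ->
  forall s s', a <= s -> s <= s' -> s' <= b -> `|x s' - x s| <= B * (s' - s).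
Proof.
move=> xv vB s s' sa ss' s'b.
have sub : `]s, s']%classic `<=` `[a, b]%classic.
  by apply: (@subset_trans _ `[s, s']); [exact: subset_itv_oc_cc|exact: subset_itvScc].
have B0 : 0 <= B.
  by apply: le_trans (vB s _); rewrite ?normr_ge0// in_itv /= sa (le_trans ss').
apply/rV_norm_leP => [|i]; first by rewrite mulr_ge0// subr_ge0.
rewrite !mxE (density_incr xv)// -Rintegral_cst_itv//.
apply: norm_Rintegral_le => //.
- by apply: integrableS (xv i).1.
- exact: integrable_cst_itv sub.
by move=> r /sub rab; apply: le_trans (rV_coord_le_norm _ _) _; exact: vB.
Qed.

Lemma Rintegral_expR (R : realType) (c a s : R) : a <= s ->
  mu.-integrable `[a, s]
    (EFin \o fun r => c * expR (c * (r - a))) /\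
  \int[mu]_(r in `[a, s]) (c * expR (c * (r - a))) =
  expR (c * (s - a)) - 1.
Proof.
move=> sa.
have dE (r : R) : is_derive r 1 (fun r : R => expR (c * (r - a))) (c * expR (c * (r - a))).
  by apply: trigger_derive; rewrite subr0 [c *: 1]mulr1 mulrC.
have cF : continuous (fun r : R => expR (c * (r - a))).
  move=> r; apply: (@continuous_comp _ _ _ (fun r => c * (r - a)) expR).
    apply: cvgM; first exact: cvg_cst.
    by apply: cvgB; [exact: cvg_id|exact: cvg_cst].
  exact: continuous_expR.
have cE : continuous (fun r : R => c * expR (c * (r - a))).
  by move=> r; apply: cvgM; [exact: cvg_cst|exact: cF].
split.
  apply: continuous_compact_integrable; first exact: segment_compact.
  exact: continuous_subspaceT.
move: sa; rewrite le_eqVlt => /predU1P[<-|sa].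
  by rewrite set_itv1 Rintegral_set1 subrr mulr0 expR0 subrr.
rewrite /Rintegral (@continuous_FTC2 _ _ (fun r : R => expR (c * (r - a))))//=.
- by rewrite subrr mulr0 expR0.
- exact: continuous_subspaceT.
- split.
  + by move=> r _; have [] := dE r.
  + exact: cvg_at_right_filter (cF a).
  + exact: cvg_at_left_filter (cF s).
- by move=> r _; rewrite derive1E; have [_ ->] := dE r.
Qed.

(** The limit is obtained as the supremum of the increasing sequence
    u k - 2 c / 2^k, which stays below the decreasing u k + 2 c / 2^k. *)
Lemma geometric_cauchy (R : realType) (u : nat -> R) (c : R) :
  (forall k, `|u k.+1 - u k| <= c / 2 ^+ k) ->
  exists l, forall k, `|l - u k| <= 2 * c / 2 ^+ k.
Proof.
move=> uc.
pose lo k := u k - 2 * c / 2 ^+ k; pose up k := u k + 2 * c / 2 ^+ k.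
have half k : c / 2 ^+ k.+1 = c / 2 ^+ k / 2.
  by rewrite exprS; field; rewrite expf_neq0.
have lo_nd : {homo lo : j k / (j <= k)%N >-> j <= k}.
  apply: homo_leq => // [|k]; first exact: le_trans.
  have := uc k; rewrite ler_norml /lo -!mulrA half => /andP[H _].
  move: H; move: (c / 2 ^+ k) => z; lra.
have up_ni : {homo up : j k / (j <= k)%N >-> k <= j}.
  apply: homo_leq => // [j k l|k]; first by move=> kj jl; exact: le_trans jl kj.
  have := uc k; rewrite ler_norml /up -!mulrA half => /andP[_ H].
  move: H; move: (c / 2 ^+ k) => z; lra.
have c0 k : 0 <= c / 2 ^+ k by apply: le_trans (uc k).
have lo_up j k : lo j <= up k.
  apply: (@le_trans _ _ (lo (maxn j k))); first exact/lo_nd/leq_maxl.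
  apply: (@le_trans _ _ (up (maxn j k))); last exact/up_ni/leq_maxr.
  by rewrite lerD2l; have := c0 (maxn j k); rewrite -mulrA; lra.
pose S := range lo.
have S0 : S !=set0 by exists (lo 0%N), 0%N.
have ubS k : ubound S (up k) by move=> _ [j _ <-].
exists (sup S) => k; rewrite ler_norml; apply/andP; split.
  have : lo k <= sup S by apply: ub_le_sup; [exists (up 0%N)|exists k].
  rewrite /lo; lra.
have : sup S <= up k by apply: ge_sup.
rewrite /up; lra.
Qed.

Section Picard.
Context (R : realType) (n : nat) (a b : R) (x0 : 'rV[R]_n) (K M : R).
Context (F : R -> 'rV[R]_n -> 'rV[R]_n).
Hypotheses (ab : a <= b) (K0 : 0 < K) (M0 : 0 <= M).
Hypothesis F_lip : forall s z z', s \in `[a, b] -> `|F s z - F s z'| <= K * `|z - z'|.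
Hypothesis F_bound : forall s, s \in `[a, b] -> `|F s x0| <= M.
Hypothesis F_meas : forall y c, (forall s s', `|y s - y s'| <= c * `|s - s'|) ->
  forall i, measurable_fun `[a, b] (fun s => F s (y s) 0 i).

(** Bounds for the distance to x0 and for the speed of the solution.  They depend
    on F through K and M only, hence are common to all controls. *)
Definition picard_radius : R := 2 * (M * (b - a)) * expR (2 * K * (b - a)).
Definition picard_speed : R := M + K * picard_radius.

Let D := picard_radius.
Let B := picard_speed.
Let E (s : R) := expR (2 * K * (s - a)).
Let clamp (s : R) := Num.max a (Num.min s b).

Let D0 : 0 <= D.
Proof. by rewrite !mulr_ge0 ?expR_ge0 ?subr_ge0. Qed.

Let clamp_in s : clamp s \in `[a, b].
Proof. by rewrite in_itv /= le_max lexx /= ge_max ab ge_min lexx orbT. Qed.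

Let clamp_id s : s \in `[a, b] -> clamp s = s.
Proof. by rewrite in_itv /= => /andP[sa sb]; rewrite /clamp min_l ?max_r. Qed.

Let clamp_le s s' : s <= s' -> 0 <= clamp s' - clamp s <= s' - s.
Proof.
move=> ss'; rewrite /clamp; case: (leP s b) => ?; case: (leP s' b) => ?.
all: case: (leP a _) => ?; try (case: (leP a _) => ?); apply/andP; split; lra.
Qed.

Let admissible (y : R -> 'rV[R]_n) :=
  (forall s s', `|y s - y s'| <= B * `|s - s'|) /\ forall s, `|y s - x0| <= D.

Let Phi (y : R -> 'rV[R]_n) (s : R) : 'rV[R]_n :=
  \row_i (x0 0 i + \int[mu]_(r in `[a, clamp s]) F r (y r) 0 i).

Let F_le y s : admissible y -> s \in `[a, b] -> `|F s (y s)| <= B.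
Proof.
move=> [_ yD] sab; rewrite -[F s (y s)](subrK (F s x0)) addrC.
apply: le_trans (ler_normD _ _) _; rewrite lerD ?F_bound//.
by apply: le_trans (F_lip _ _ sab) _; rewrite ler_wpM2l// ltW.
Qed.

Let F_int y i : admissible y ->
  mu.-integrable `[a, b] (EFin \o fun s => F s (y s) 0 i).
Proof.
move=> ady; apply: (@bounded_itv_integrable _ _ B a b) => //.
  exact: F_meas ady.1 i.
by move=> s sab; apply: le_trans (rV_coord_le_norm _ _) _; exact: F_le.
Qed.

Let Phi_density y : admissible y -> density a b (Phi y) (fun s => F s (y s)).
Proof.
move=> ady i; split; first exact: F_int.
move=> s sab; rewrite !mxE !clamp_id// ?set_itv1 ?Rintegral_set1 ?addr0//.
by rewrite in_itv /= lexx.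
Qed.

Let Phi_clamp y s : Phi y s = Phi y (clamp s).
Proof. by apply/rowP => i; rewrite !mxE (clamp_id (clamp_in s)). Qed.

Let Phi_lipschitz y : admissible y ->
  forall s s', `|Phi y s - Phi y s'| <= B * `|s - s'|.
Proof.
move=> ady; have B0 : 0 <= B by rewrite addr_ge0// mulr_ge0// ltW.
have wl s s' : s <= s' -> `|Phi y s' - Phi y s| <= B * (s' - s).
  move=> ss'; have /andP[c1 c2] := clamp_le ss'.
  rewrite (Phi_clamp y s) (Phi_clamp y s').
  apply: (@le_trans _ _ (B * (clamp s' - clamp s))); last exact: ler_wpM2l.
  have := clamp_in s; have := clamp_in s'; rewrite !in_itv /= => /andP[_ ?] /andP[? _].
  apply: (density_lipschitz (Phi_density ady)) => //; last by rewrite -subr_ge0.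
  by move=> r; exact: F_le.
move=> s s'; have [ss'|s's] := leP s s'.
  by rewrite distrC (distrC s) (ger0_norm (_ : 0 <= s' - s)) ?subr_ge0// wl.
by rewrite (ger0_norm (_ : 0 <= s - s')) ?subr_ge0 ?wl// ltW.
Qed.

Let E_mono s s' : s <= s' -> E s <= E s'.
Proof. by move=> ss'; rewrite ler_expR ler_wpM2l ?lerD2r// mulr_ge0// ltW. Qed.

Let E_ge1 s : a <= s -> 1 <= E s.
Proof. by move=> sa; rewrite -expR0 ler_expR mulr_ge0 ?subr_ge0// mulr_ge0// ltW. Qed.

(** In the norm weighted by exp(2 K (s - a)) the Picard map contracts by 1/2 on the
    whole interval, so no subdivision is needed. *)
Let Phi_contract y y' C : admissible y -> admissible y' -> 0 <= C ->
  (forall s, s \in `[a, b] -> `|y s - y' s| <= C * E s) ->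
  forall s, s \in `[a, b] -> `|Phi y s - Phi y' s| <= C / 2 * E s.
Proof.
move=> ady ady' C0 yy' s sab.
have [sa sb] : a <= s /\ s <= b by move: sab; rewrite in_itv => /andP[].
have sub : `[a, s]%classic `<=` `[a, b]%classic by apply: subset_itvScc.
apply/rV_norm_leP => [|i]; first by rewrite mulr_ge0 ?expR_ge0// divr_ge0.
have iy z : admissible z -> mu.-integrable `[a, s]
    (EFin \o fun s => F s (z s) 0 i).
  by move=> adz; apply: integrableS (F_int i adz).
rewrite !mxE clamp_id// opprD addrACA subrr add0r -RintegralB//; [|exact: iy..].
have [iE IE] := Rintegral_expR (2 * K) sa.
apply: (@le_trans _ _ (\int[mu]_(r in `[a, s])
    (C / 2 * (2 * K * expR (2 * K * (r - a)))))).
  apply: norm_Rintegral_le => //.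
  - by apply: (integrableB _ (iy _ ady) (iy _ ady')).
  - by apply: (integrableZl _ (C / 2) iE).
  move=> r rab; apply: (@le_trans _ _ (`|F r (y r) - F r (y' r)|)).
    by have := rV_coord_le_norm (F r (y r) - F r (y' r)) i; rewrite !mxE.
  have rab' : r \in `[a, b] by exact: sub.
  apply: le_trans (F_lip _ _ rab') _.
  have -> : C / 2 * (2 * K * expR (2 * K * (r - a))) = K * (C * E r) by rewrite /E; field.
  by rewrite ler_pM2l// yy'.
rewrite RintegralZl// IE ler_wpM2l ?divr_ge0//.
by rewrite gerBl.
Qed.

Let iterate k := iter k Phi (fun=> x0).

Let clamp_bounds s : a <= clamp s /\ clamp s <= b.
Proof. by have := clamp_in s; rewrite in_itv => /andP[]. Qed.

Let first_step s : s \in `[a, b] -> `|Phi (fun=> x0) s - x0| <= M * (b - a).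
Proof.
have ad0 : admissible (fun=> x0).
  split=> [s1 s2|s1]; rewrite subrr normr0//.
  by rewrite !mulr_ge0// addr_ge0// mulr_ge0// ltW.
rewrite in_itv => /= /andP[sa sb].
have Pa : Phi (fun=> x0) a = x0.
  apply/rowP => i; rewrite mxE clamp_id ?set_itv1 ?Rintegral_set1 ?addr0//.
  by rewrite in_itv /= lexx.
rewrite -{2}Pa.
apply: (@le_trans _ _ (M * (s - a))); last by rewrite ler_wpM2l// lerD2r.
exact: (density_lipschitz (Phi_density ad0)).
Qed.

Let iterates_close k : admissible (iterate k) /\
  (forall s, s \in `[a, b] ->
    `|iterate k.+1 s - iterate k s| <= M * (b - a) / 2 ^+ k * E s) /\
  (forall s, `|iterate k s - x0| <= D * (1 - (2 ^+ k)^-1)).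
Proof.
have Mba : 0 <= M * (b - a) by rewrite mulr_ge0// subr_ge0.
have halfpow (k' : nat) : (2 ^+ k'.+1)^-1 = (2 ^+ k')^-1 / 2 :> R.
  by rewrite exprS invfM mulrC.
have pow0 (k' : nat) : 0 < (2 ^+ k')^-1 :> R by rewrite invr_gt0 exprn_gt0.
elim: k => [|k [adk [stepk distk]]].
  split; [split=> [s s'|s]; rewrite /= subrr normr0// |split=> [s sab|s]].
  - by rewrite !mulr_ge0// addr_ge0// mulr_ge0// ltW.
  - rewrite /= expr0 divr1; apply: le_trans (first_step sab) _.
    by rewrite ler_peMr// E_ge1//; move: sab; rewrite in_itv => /andP[].
  - by rewrite /= subrr normr0 expr0 invr1 subrr mulr0.
have distk1 s : `|iterate k.+1 s - x0| <= D * (1 - (2 ^+ k.+1)^-1).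
  have -> : iterate k.+1 s = iterate k.+1 (clamp s) by exact: Phi_clamp.
  rewrite -(subrK (iterate k (clamp s)) (iterate k.+1 _)) -addrA.
  apply: le_trans (ler_normD _ _) _.
  apply: (@le_trans _ _ (M * (b - a) / 2 ^+ k * E b + D * (1 - (2 ^+ k)^-1))).
    rewrite lerD ?distk//; apply: le_trans (stepk _ (clamp_in s)) _.
    rewrite ler_wpM2l ?E_mono ?(clamp_bounds s).2//.
    by rewrite mulr_ge0// ltW.
  rewrite halfpow /D /picard_radius -/(E b) le_eqVlt; apply/orP; left.
  by apply/eqP; field; rewrite expf_neq0.
have adk1 : admissible (iterate k.+1).
  split; first exact: Phi_lipschitz.
  move=> s; apply: le_trans (distk1 s) _.
  by rewrite ler_piMr// gerBl ltW.
split => //; split=> // s sab.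
have C0 : 0 <= M * (b - a) / 2 ^+ k by rewrite mulr_ge0// ltW.
by rewrite halfpow mulrA; exact: (Phi_contract adk1 adk C0 stepk sab).
Qed.

(** All iterates, and hence their limit, share the Lipschitz constant
    [picard_speed]; this is why measurability is asked for along Lipschitz curves. *)
Lemma picard : exists y : R -> 'rV[R]_n,
  [/\ y a = x0, density a b y (fun s => F s (y s))
    & forall s s', `|y s - y s'| <= B * `|s - s'|].
Proof.
have Mba : 0 <= M * (b - a) by rewrite mulr_ge0// subr_ge0.
have pow0 (k' : nat) : 0 < (2 ^+ k')^-1 :> R by rewrite invr_gt0 exprn_gt0.
have lim_ex (s : R) (i : 'I_n) : exists l : R,
    forall k, `|l - iterate k s 0 i| <= D / 2 ^+ k.
  have [|l lP] := @geometric_cauchy R (fun k => iterate k s 0 i) (M * (b - a) * E b).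
    move=> k; have := rV_coord_le_norm (iterate k.+1 s - iterate k s) i.
    rewrite !mxE => /le_trans; apply.
    have -> : iterate k.+1 s = iterate k.+1 (clamp s) by exact: Phi_clamp.
    have -> : iterate k s = iterate k (clamp s) by case: (k) => // j; exact: Phi_clamp.
    apply: le_trans ((iterates_close k).2.1 _ (clamp_in s)) _.
    rewrite mulrAC; apply: ler_wpM2r; first exact/ltW/pow0.
    by apply: ler_wpM2l => //; exact/E_mono/(clamp_bounds s).2.
  by exists l => k; apply: le_trans (lP k) _; rewrite /D /picard_radius !mulrA.
pose y s : 'rV[R]_n := \row_i sval (cid (lim_ex s i)).
have yk k s : `|y s - iterate k s| <= D / 2 ^+ k.
  apply/rV_norm_leP => [|i]; first by rewrite mulr_ge0// ltW.
  by rewrite !mxE; exact: (svalP (cid (lim_ex s i))).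
have small (u c : R) : 0 <= c -> (forall k : nat, u <= c / 2 ^+ k) -> u <= 0.
  move=> c0 uc; apply/ler_addgt0Pr => e e0; rewrite add0r.
  have [k kP] : exists k : nat, c / e <= 2 ^+ k.
    exists (Num.truncn (c / e)).+1.
    apply: (@le_trans _ _ (Num.truncn (c / e)).+1%:R); first by rewrite ltW ?truncnS_gt.
    by rewrite -natrX ler_nat ltnW// ltn_expl.
  apply: le_trans (uc k) _; rewrite ler_pdivrMr ?exprn_gt0//.
  by rewrite mulrC -ler_pdivrMr.
have yad : admissible y.
  split=> [s s'|s].
    rewrite -subr_le0; apply: (small _ (2 * D)) => [|k]; first by rewrite mulr_ge0.
    rewrite lerBlDr.
    have -> : y s - y s' = (y s - iterate k s) +
        ((iterate k s - iterate k s') + (iterate k s' - y s')).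
      by rewrite addrA !addrA subrK subrK.
    apply: le_trans (ler_normD _ _) _; have := yk k s.
    have := ler_normD (iterate k s - iterate k s') (iterate k s' - y s').
    have := yk k s'; rewrite (distrC (y s')).
    have := (iterates_close k).1.1 s s'; rewrite -mulrA.
    move: (D / _) => w; lra.
  rewrite -subr_le0; apply: (small _ D) => // k; rewrite lerBlDr.
  rewrite -(subrK (iterate k s) (y s)) -addrA; apply: le_trans (ler_normD _ _) _.
  by rewrite lerD// ((iterates_close k).1.2 s).
have yPhi s : s \in `[a, b] -> y s = Phi y s.
  move=> sab; apply/eqP; rewrite -subr_eq0 -normr_le0.
  have [sa sb] : a <= s /\ s <= b by move: sab; rewrite in_itv => /andP[].
  apply: (small _ (D * E b)) => [|k]; first by rewrite mulr_ge0// expR_ge0.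
  rewrite -(subrK (iterate k.+1 s) (y s)) -addrA; apply: le_trans (ler_normD _ _) _.
  have contr : `|Phi (iterate k) s - Phi y s| <= D / 2 ^+ k / 2 * E s.
    apply: Phi_contract => //; first exact: (iterates_close k).1.
      by rewrite mulr_ge0// ltW.
    move=> r; rewrite in_itv /= => /andP[ra rb]; rewrite distrC.
    apply: le_trans (yk k r) _; rewrite ler_peMr ?E_ge1//.
    by rewrite mulr_ge0// ltW.
  have y1 := yk k.+1 s.
  have Ds : D / 2 ^+ k.+1 = D / 2 ^+ k / 2.
    by rewrite exprS; field; rewrite expf_neq0.
  rewrite Ds in y1.
  have w0 : 0 <= D / 2 ^+ k by rewrite mulr_ge0// ltW.
  rewrite mulrAC.
  have := E_mono sb; have := E_ge1 (le_trans sa sb); have := E_ge1 sa.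
  change (iterate k.+1 s) with (Phi (iterate k) s) in y1 |- *.
  move: (D / _) (E s) (E b) w0 y1 contr => w e1 e2; nra.
exists y; split; last exact: yad.1.
  have aab : a \in `[a, b] by rewrite in_itv /= lexx.
  by rewrite yPhi//; apply/rowP => i; rewrite mxE clamp_id// set_itv1 Rintegral_set1 addr0.
move=> i; have [iF PF] := Phi_density yad i; split => // s sab.
by rewrite yPhi// PF// -yPhi// in_itv /= lexx.
Qed.

End Picard.

(** * Approximation of a relaxed curve by a trajectory *)

Lemma lipschitz_measurable (R : realType) (phi : R -> R) (c : R) :
  (forall s s', `|phi s - phi s'| <= c * `|s - s'|) -> measurable_fun setT phi.
Proof.
move=> phic; apply: continuous_measurable_fun => s; apply/cvgrPdist_le => e e0.
have c0 : 0 < `|c| + 1 by rewrite ltr_wpDl.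
near=> r; apply: le_trans (phic _ _) _.
apply: (@le_trans _ _ ((`|c| + 1) * `|s - r|)).
  by rewrite ler_wpM2r// (le_trans (ler_norm c))// lerDl.
rewrite -ler_pdivlMl//; near: r.
by apply: cvgr_dist_le; rewrite ?mulr_gt0 ?invr_gt0//; exact: cvg_id.
Unshelve. all: by end_near. Qed.

Lemma clamp_dist (R : realType) (T s s' : R) :
  `|Num.max 0 (Num.min s T) - Num.max 0 (Num.min s' T)| <= `|s - s'|.
Proof.
wlog ss' : s s' / s' <= s.
  by move=> H; have [/H//|/ltW/H] := leP s' s; rewrite distrC (distrC s).
rewrite [leRHS]ger0_norm ?subr_ge0// ler_norml.
case: (leP s T) => ?; case: (leP s' T) => ?.
all: case: (leP 0 _) => ?; try (case: (leP 0 _) => ?); apply/andP; split; lra.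
Qed.

(** The Lipschitz condition holds for times in [0, T] only; clamping the time makes
    the integrand continuous on the whole line for each fixed control. *)
Lemma measurable_along (R : realType) (n m : nat) (T : R) (U : set 'rV[R]_m)
    (h : R -> 'rV[R]_n -> 'rV[R]_m -> R) (k c t : R) u y :
  0 <= t -> 0 < T -> 0 <= k ->
  uniformly_lipschitz (W := R) T U k h -> step_control U u ->
  (forall s s', `|y s - y s'| <= c * `|s - s'|) ->
  measurable_fun `[t, T] (fun s => h s (y s) (u s)).
Proof.
move=> t0 T0 k0 hk su yc.
pose phi s a := h (Num.max 0 (Num.min s T)) (y s) a.
have clampT s : Num.max 0 (Num.min s T) \in `[0, T].
  by rewrite in_itv /= le_max lexx ge_max (ltW T0) ge_min lexx orbT.
have mphi : measurable_fun setT (fun s => phi s (u s)).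
  apply: step_control_measurable su _ => a Ua.
  apply: (@lipschitz_measurable _ _ (k * (1 + `|c|))) => s s'.
  rewrite -mulrA; apply: hk => //.
    apply: le_trans (clamp_dist _ _ _) _.
    by rewrite ler_peMl// lerDl.
  apply: le_trans (yc _ _) _; rewrite ler_wpM2r//.
  by rewrite (le_trans (ler_norm c))// lerDr.
apply: (@eq_measurable_fun _ _ _ _ _ (fun s => phi s (u s))); last exact: measurable_funTS.
move=> s; rewrite inE /= in_itv /= => /andP[ts sT].
by rewrite /phi min_l// max_r// (le_trans t0).
Qed.

Lemma integrable_along (R : realType) (n m : nat) (T : R) (U : set 'rV[R]_m)
    (psi : R -> 'rV[R]_n -> 'rV[R]_m -> R) (k B t : R) u y :
  0 <= t <= T -> 0 < T -> 0 <= k -> 0 <= B ->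
  uniformly_lipschitz (W := R) T U k psi -> step_control U u ->
  (forall s s', `|y s - y s'| <= B * `|s - s'|) ->
  mu.-integrable `[t, T] (EFin \o fun s => psi s (y s) (u s)).
Proof.
move=> /andP[t0 tT] T0 k0 B0 psik su yB.
have [b ub] := step_control_bounded (psi t (y t)) su.
apply: (@bounded_itv_integrable _ _ (k * ((1 + B) * (T - t)) + b) t T) => //.
  exact: measurable_along psik su yB.
move=> s; rewrite in_itv /= => /andP[ts sT].
rewrite -(subrK (psi t (y t) (u s)) (psi s _ _)); apply: le_trans (ler_normD _ _) _.
rewrite lerD//; have sd : `|s - t| <= T - t by rewrite ger0_norm ?subr_ge0// lerD2r.
have S0 : 0 <= T - t by rewrite subr_ge0.
apply: psik; first exact: step_control_in su _.
- by rewrite in_itv /= (le_trans t0).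
- by rewrite in_itv /= t0.
- by apply: le_trans sd _; rewrite ler_peMl// lerDl.
apply: le_trans (yB _ _) _; apply: (@le_trans _ _ (B * (T - t))); first exact: ler_wpM2l.
by rewrite ler_wpM2r// lerDr.
Qed.

Lemma glue_controls (R : realType) (m : nat) (U : set 'rV[R]_m)
    (c : nat -> R) (v : nat -> R -> 'rV[R]_m) :
  U !=set0 -> {homo c : i j / (i <= j)%N >-> i <= j} ->
  (forall j, step_control U (v j)) -> forall N,
  exists2 u, step_control U u &
    forall j, (j < N)%N -> forall s, s \in `]c j, c j.+1] -> u s = v j s.
Proof.
move=> [a Ua] c_nd sv; elim=> [|N [u su uP]].
  by exists (fun=> a); [exact: step_cst|].
exists (fun s => if s <= c N then u s else v N s); first exact: step_glue.
move=> j; rewrite ltnS leq_eqVlt => /predU1P[->|jN] s.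
  by rewrite in_itv /= => /andP[cs _]; rewrite leNgt cs.
move=> sj; rewrite ifT ?(uP j)//; move: sj; rewrite in_itv /= => /andP[_ sj].
by apply: (le_trans sj); exact: c_nd.
Qed.

(** psi may be negative: it is compared with G through its positive part. *)
Lemma Rintegral_le_lower (R : realType) (i : interval R) (psi : R -> R) (G : R -> \bar R) :
  mu.-integrable [set` i] (EFin \o psi) ->
  (forall s, s \in i -> (0 <= G s)%E) ->
  {ae mu, forall s, s \in i -> ((psi s)%:E <= G s)%E} ->
  ((\int[mu]_(s in [set` i]) psi s)%:E
    <= \int[mu]_(s in [set` i]) G s)%E.
Proof.
move=> ipsi G0 psiG.
have fin : (\int[mu]_(s in [set` i]) (psi s)%:E)%E \is a fin_num.
  by apply: integrable_fin_num.
rewrite /Rintegral fineK//.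
apply: (@le_trans _ _ (\int[mu]_(s in [set` i]) ((EFin \o psi)^\+ s))%E).
  rewrite integralE geeDl// oppe_le0; apply: integral_ge0 => s _.
  exact: funeneg_ge0.
apply: ge0_ae_le_integral_lower => //.
apply: aeS psiG => s H Ds; by rewrite /= funeposE ge_max H//; exact: G0.
Qed.

(** The error satisfies E j <= (1 + h k)^j times the accumulated source terms, and
    1 + h k <= exp(h k). *)
Lemma discrete_gronwall (R : realType) (h k r : R) (E q : nat -> R) (N : nat) :
  0 <= h -> 0 <= k -> 0 <= r -> (forall j, 0 <= q j) -> E 0%N = 0 ->
  (forall j, (j < N)%N -> E j.+1 <= E j + h * k * E j + h * q j + h * r) ->
  forall j, (j <= N)%N ->
  E j <= expR (k * (h * N%:R)) * (\sum_(i < j) h * q i + h * j%:R * r).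
Proof.
move=> h0 k0 r0 q0 E0 Estep.
have hk0 : 0 <= h * k by rewrite mulr_ge0.
have S0 j : 0 <= \sum_(i < j) h * q i + h * j%:R * r.
  by rewrite addr_ge0 ?sumr_ge0 ?mulr_ge0// => i _; rewrite mulr_ge0.
have pow j : (j <= N)%N -> E j <= (1 + h * k) ^+ j * (\sum_(i < j) h * q i + h * j%:R * r).
  elim: j => [_|j IH jN]; first by rewrite E0 big_ord0 mulr0 mul0r addr0 mulr0.
  apply: le_trans (Estep j jN) _; have := IH (ltnW jN).
  rewrite big_ord_recr /= exprS -natr1.
  have p1 : 1 <= (1 + h * k) ^+ j by rewrite exprn_ege1// lerDl.
  have hq : 0 <= h * q j by rewrite mulr_ge0.
  have hr : 0 <= h * r by rewrite mulr_ge0.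
  have := S0 j; move: (\sum_(i < j) _) ((1 + h * k) ^+ j) p1 => s p p1 s0 Ej.
  have : (1 + h * k) * E j <= (1 + h * k) * (p * (s + h * j%:R * r)).
    by rewrite ler_wpM2l// addr_ge0.
  have : h * q j + h * r <= (1 + h * k) * (p * (h * q j + h * r)).
    rewrite mulrA ler_peMl ?addr_ge0//.
    by rewrite -[leLHS]mulr1 ler_pM// lerDl.
  lra.
move=> j jN; apply: le_trans (pow j jN) _; rewrite ler_wpM2r//.
apply: (@le_trans _ _ (expR (h * k) ^+ j)).
  by rewrite lerXn2r ?nnegrE ?expR_ge0 ?addr_ge0// expR_ge1Dx.
rewrite -expRM_natl ler_expR.
have -> : k * (h * N%:R) = N%:R * (h * k) by ring.
by rewrite ler_wpM2r// ler_nat.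
Qed.

Lemma mean_coord (R : realType) (A : eqType) n (phi : A -> 'rV[R]_n) l i :
  mean phi l 0 i = mean (V := R^o) (fun a => phi a 0 i) l.
Proof. by rewrite /mean summxE; apply: eq_bigr => wa _; rewrite mxE. Qed.

Lemma chattering_mean (R : realType) (m : nat) (U : set 'rV[R]_m)
    (l : seq (R * 'rV[R]_m)) (c h : R) : U !=set0 -> convex_weights U l -> 0 <= h ->
  exists2 u, step_control U u & forall phi : 'rV[R]_m -> R,
    \int[mu]_(s in `]c, c + h]) phi (u s) = h * mean (V := R^o) phi l.
Proof.
move=> U0 [l0 l1] h0; pose hl := [seq (h * wa.1, wa.2) | wa <- l].
have hlP wa : wa \in hl -> 0 <= wa.1 /\ U wa.2.
  by move=> /mapP[wb /l0[w0 Uw] ->]; split => //=; rewrite mulr_ge0.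
have [u su uP] := chattering c U0 hlP.
exists u => // phi; have := uP phi.
rewrite !big_map /= -mulr_sumr l1 mulr1 => ->.
by rewrite /mean mulr_sumr; apply: eq_bigr => wa _; rewrite -mulrA.
Qed.

(** Along a block, psi s (y s) differs from its value at the reference point (c, z)
    by at most k times the distance, and at the reference point the control enters
    only through its occupation times. *)
Lemma block_average (R : realType) (n m : nat) (T : R) (U : set 'rV[R]_m)
    (psi : R -> 'rV[R]_n -> 'rV[R]_m -> R) (k B t c h : R) u y z
    (l : seq (R * 'rV[R]_m)) :
  0 < T -> 0 <= k -> 0 <= B -> uniformly_lipschitz (W := R) T U k psi ->
  step_control U u -> (forall s s', `|y s - y s'| <= B * `|s - s'|) ->
  0 <= t -> t <= c -> 0 <= h -> c + h <= T ->
  (forall phi : 'rV[R]_m -> R,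
    \int[mu]_(s in `]c, c + h]) phi (u s) = h * mean (V := R^o) phi l) ->
  `|\int[mu]_(s in `]c, c + h]) psi s (y s) (u s)
    - h * mean (V := R^o) (psi c z) l| <= h * (k * (`|y c - z| + (1 + B) * h)).
Proof.
move=> T0 k0 B0 psik su yB t0 tc h0 chT uP.
have sub : `]c, c + h]%classic `<=` `[c, c + h]%classic by exact: subset_itv_oc_cc.
pose rho := `|y c - z| + (1 + B) * h.
have dev s : s \in `]c, c + h] -> `|psi s (y s) (u s) - psi c z (u s)| <= k * rho.
  rewrite in_itv /= => /andP[cs sch].
  have sc : `|s - c| <= h by rewrite gtr0_norm ?subr_gt0// lerBlDl.
  apply: psik; first exact: step_control_in su _.
  - by rewrite in_itv /= (le_trans t0) ?(le_trans tc) ?(ltW cs)// (le_trans sch).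
  - by rewrite in_itv /= (le_trans t0 tc) (le_trans _ chT)// lerDl.
  - by apply: le_trans sc _; rewrite /rho mulrDl mul1r addrCA lerDl addr_ge0// mulr_ge0.
  rewrite -(subrK (y c) (y s)) -addrA; apply: le_trans (ler_normD _ _) _.
  rewrite /rho [leRHS]addrC lerD2r; apply: le_trans (yB _ _) _.
  by rewrite mulrDl mul1r ler_wpDl// ler_wpM2l.
have iref : mu.-integrable `]c, c + h] (EFin \o fun s => psi c z (u s)).
  have [b ub] := step_control_bounded (psi c z) su.
  apply: (@bounded_itv_integrable _ _ b c (c + h)) => //.
  by apply: measurable_funTS; apply: (step_control_measurable (phi := fun=> psi c z)) su _.
have ipsi : mu.-integrable `]c, c + h] (EFin \o fun s => psi s (y s) (u s)).
  have tT : 0 <= t <= T by rewrite t0 (le_trans tc)// (le_trans _ chT)// lerDl.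
  apply: integrableS (integrable_along tT T0 k0 B0 psik su yB) => //.
  move=> s; rewrite /= !in_itv /= => /andP[cs sch].
  by rewrite (le_trans tc) ?(ltW cs)//= (le_trans sch).
rewrite -uP -RintegralB//.
have -> : h * (k * rho) = \int[mu]_(s in `]c, c + h]) (k * rho).
  by rewrite Rintegral_cst_itv ?lerDl// addrAC subrr add0r mulrC.
apply: norm_Rintegral_le => //; first by apply: (integrableB _ ipsi iref).
exact: integrable_cst_itv sub.
Qed.

Lemma density_dot (R : realType) n (a b : R) (x v : R -> 'rV[R]_n) p :
  density a b x v -> forall s s', a <= s -> s <= s' -> s' <= b ->
  mu.-integrable `]s, s'] (EFin \o fun r => dot p (v r)) /\
  \int[mu]_(r in `]s, s']) dot p (v r) = dot p (x s' - x s).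
Proof.
move=> xv s s' sa ss' s'b.
have iv i : mu.-integrable `]s, s'] (EFin \o fun r => v r 0 i).
  apply: integrableS (xv i).1 => // r; rewrite /= !in_itv /= => /andP[sr rs'].
  by rewrite (le_trans sa (ltW sr)) (le_trans rs').
have ipv i : mu.-integrable `]s, s']
    (EFin \o fun r => p 0 i * v r 0 i) by apply: (integrableZl _ _ (iv i)).
have -> : dot p (x s' - x s) =
    \sum_(i < n) \int[mu]_(r in `]s, s']) (p 0 i * v r 0 i).
  by apply: eq_bigr => i _; rewrite !mxE (density_incr xv)// RintegralZl//; exact: iv.
rewrite /dot; elim: (index_enum _) => [|i l [il Il]].
  have -> : (fun r => \sum_(j <- [::]) p 0 j * v r 0 j) = fun=> 0.
    by apply/funext => r; rewrite big_nil.
  split; last by rewrite big_nil Rintegral_cst_itv// mul0r.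
  by apply: (@integrable_cst_itv _ _ s s'); exact: subset_itv_oc_cc.
have sumE : (fun r => \sum_(j <- i :: l) p 0 j * v r 0 j) =
    fun r => p 0 i * v r 0 i + \sum_(j <- l) p 0 j * v r 0 j.
  by apply/funext => r; rewrite big_cons.
rewrite sumE big_cons; split; first by apply: (integrableD _ (ipv i) il).
by rewrite RintegralD// Il.
Qed.

Section NearOptimal.
Context (R : realType) (n m : nat) (T : R) (U : set 'rV[R]_m).
Context (f : R -> 'rV[R]_n -> 'rV[R]_m -> 'rV[R]_n).
Context (L : R -> 'rV[R]_n -> 'rV[R]_m -> R) (g : 'rV[R]_n -> R) (k M0 : R).
Hypotheses (T0 : 0 < T) (U0 : U !=set0) (k0 : 0 < k).
Hypothesis f_lip : uniformly_lipschitz T U k f.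
Hypothesis L_lip : uniformly_lipschitz (W := R) T U k L.
Hypothesis g_lip : forall z z', `|g z - g z'| <= k * `|z - z'|.
Hypothesis L_ge0 : forall t x a, t \in `[0, T] -> U a -> 0 <= L t x a.
Hypothesis f_bound : forall a, U a -> `|f 0 0 a| <= M0.

Let T_in0 : 0 \in `[0, T].
Proof. by rewrite in_itv /= lexx ltW. Qed.

Lemma field_linear_growth s z a : s \in `[0, T] -> U a ->
  `|f s z a| <= M0 + k * (T + `|z|).
Proof.
move=> sT Ua; rewrite -(subrK (f 0 0 a) (f s z a)) addrC.
apply: le_trans (ler_normD _ _) _; rewrite lerD ?f_bound//.
have /andP[s0 sT'] : (0 <= s) && (s <= T) by move: sT; rewrite in_itv.
apply: f_lip => //; rewrite subr0; last by rewrite lerDr ltW.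
by rewrite ger0_norm// (le_trans sT')// lerDl.
Qed.

Lemma field_coord_lip i :
  uniformly_lipschitz (W := R) T U k (fun s z a => f s z a 0 i).
Proof.
move=> a s s' z z' d Ua sT s'T sd zd.
have := rV_coord_le_norm (f s z a - f s' z' a) i; rewrite !mxE => /le_trans; apply.
exact: f_lip.
Qed.

(** The speed bound B does not depend on the control, so the block length can be
    chosen before the control is known. *)
Lemma controlled_trajectory (t : R) (x0 : 'rV[R]_n) : 0 <= t <= T ->
  exists2 B, 0 <= B & forall u, step_control U u ->
    exists y : R -> 'rV[R]_n, [/\ y t = x0,
      density t T y (fun s => f s (y s) (u s))
      & forall s s', `|y s - y s'| <= B * `|s - s'|].
Proof.
move=> /andP[t0 tT]; have [a0 Ua0] := U0.
have M00 : 0 <= M0 by apply: le_trans (f_bound Ua0).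
pose M := M0 + k * (T + `|x0|).
have M_ge0 : 0 <= M by rewrite addr_ge0// mulr_ge0 ?addr_ge0// ltW.
exists (picard_speed t T k M).
  rewrite addr_ge0// mulr_ge0 ?(ltW k0)// mulr_ge0 ?expR_ge0//.
  by rewrite !mulr_ge0// subr_ge0.
have inT s : s \in `[t, T] -> s \in `[0, T].
  by rewrite !in_itv /= => /andP[ts ->]; rewrite (le_trans t0).
move=> u su; apply: (@picard R n t T x0 k M (fun s z => f s z (u s))) => //.
- move=> s z z' /inT sT; apply: f_lip => //; first exact: step_control_in su _.
  by rewrite subrr normr0.
- by move=> s /inT sT; apply: field_linear_growth => //; exact: step_control_in su _.
- move=> y c yc i.
  exact: (measurable_along t0 T0 (ltW k0) (@field_coord_lip i) su yc).
Qed.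

(** The total running cost of the combinations, penalties included, is at most
    C + 4 (T - t) e because the lower bounds of [penalized_subgradient] have an
    explicit integral on each block; the penalty A h q of a block compensates what
    its velocity defect q costs later. *)
Lemma near_optimal_control (t : R) x v w (C e : R) :
  0 <= t <= T -> density t T x v ->
  {ae mu, forall s, s \in `[t, T] -> w s = - v s} ->
  (\int[mu]_(s in `[t, T])
     hamiltonian_conj U f L s (x s) (w s) <= C%:E)%E ->
  0 < e ->
  exists u y, [/\ step_control U u, y t = x t,
    density t T y (fun s => f s (y s) (u s)),
    mu.-integrable `[t, T] (EFin \o fun s => L s (y s) (u s))
    & \int[mu]_(s in `[t, T]) L s (y s) (u s) + g (y T)
      <= C + g (x T) + (4 * (T - t) + 1) * e].
Proof.
move=> tT xv wv HC e0; have /andP[t0 tT'] := tT.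
have [B B0 traj] := controlled_trajectory (x t) tT.
set S := T - t; have S0 : 0 <= S by rewrite subr_ge0.
(* The Lipschitz constant of the total cost with respect to the velocity defects:
   Gronwall's factor, times k S for the running cost plus k for g. *)
pose A := (k * S + k) * expR (k * S).
have A0 : 0 < A by rewrite mulr_gt0 ?expR_gt0// ltr_wpDl// mulr_ge0// ltW.
have [d d0 pen] := penalized_subgradient k0 A0 e0 U0 f_lip L_lip.
have [d2 d20 ux] := density_unif_continuous xv d0.
(* h Q is the total effect of the variation of time and of y within blocks. *)
pose Q := k * (1 + B) * S * (A + 1).
have kB0 : 0 <= k * (1 + B) by rewrite mulr_ge0 ?addr_ge0// ltW.
have Q0 : 0 <= Q by apply: mulr_ge0; [exact: mulr_ge0|rewrite addr_ge0// ltW].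
pose eta := Num.min (Num.min d d2) (e / (Q + 1)).
have eta0 : 0 < eta by rewrite !lt_min d0 d20 divr_gt0// ltr_wpDl.
pose N := (Num.truncn (S / eta)).+1; pose h := S / N%:R.
have hN : h * N%:R = S by rewrite /h divfK// pnatr_eq0.
have h0 : 0 <= h by rewrite divr_ge0.
have heta : h < eta.
  by rewrite /h ltr_pdivrMr// mulrC -ltr_pdivrMr// /N truncnS_gt// divr_ge0// ltW.
have [hd hd2 hQ] : [/\ h <= d, h < d2 & h * Q <= e].
  move: heta; rewrite !lt_min => /andP[/andP[hd hd2] he]; split=> //; first exact: ltW.
  apply: (@le_trans _ _ (h * (Q + 1))); first by rewrite ler_wpM2l// lerDl.
  by rewrite -ler_pdivlMr ?ltr_wpDl// ltW.
pose c (j : nat) := t + j%:R * h.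
have cS j : c j.+1 = c j + h by rewrite /c -natr1 mulrDl mul1r addrA.
have c_ge j : t <= c j by rewrite lerDl mulr_ge0.
have c_nd : {homo c : i j / (i <= j)%N >-> i <= j}.
  by move=> i j ij; rewrite lerD2l ler_wpM2r// ler_nat.
have cN : c N = T by rewrite /c mulrC hN addrC subrK.
have c_le j : (j <= N)%N -> c j <= T by move=> jN; rewrite -cN c_nd.
have cT j : (j <= N)%N -> c j \in `[0, T].
  by move=> jN; rewrite in_itv /= c_le// (le_trans t0).
pose b j := - h^-1 *: (x (c j.+1) - x (c j)).
have hb j : (j < N)%N -> h *: b j = x (c j) - x (c j.+1).
  (* For t = T all blocks are empty: then h = 0 and x does not move either. *)
  move=> jN; rewrite /b scalerA mulrN; have [hz|hn0] := eqVneq h 0.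
    by rewrite hz mul0r oppr0 scale0r cS hz addr0 subrr.
  by rewrite mulfV// scaleN1r opprB.
have [a0 Ua0] := U0.
have /choice[lp lpP] j : exists lp : seq (R * 'rV[R]_m) * 'rV[R]_n,
    convex_weights U lp.1 /\ ((j < N)%N -> forall s z, s \in `]c j, c j.+1] ->
    ((dot lp.2 (z - b j) + A * `|mean (f (c j) (x (c j))) lp.1 + b j|
        + mean (V := R^o) (L (c j) (x (c j))) lp.1 - 4 * e)%:E
        <= hamiltonian_conj U f L s (x s) z)%E).
  have [jN|Nj] := boolP (j < N)%N; last first.
    by exists ([:: (1, a0)], 0); split => //; exact: convex_weights1.
  have [l [p [wl lpP]]] := pen (M0 + k * (T + `|x (c j)|)) (c j) (x (c j)) (b j)
    (cT j (ltnW jN)) (fun a Ua => field_linear_growth (x (c j)) (cT j (ltnW jN)) Ua)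
    (fun a Ua => L_ge0 (x (c j)) (cT j (ltnW jN)) Ua).
  exists (l, p); split => // _ s z; rewrite in_itv /= cS => /andP[cs sc].
  have sT : s <= T by apply: le_trans sc _; rewrite -cS c_le.
  have scj : s - c j <= h by rewrite lerBlDl.
  apply: lpP.
  - by rewrite in_itv /= sT (le_trans t0) ?(le_trans (c_ge j)) ?ltW.
  - by rewrite gtr0_norm ?subr_gt0// (le_trans scj).
  - by apply: ux => //; [exact: ltW|exact: le_lt_trans hd2].
pose l j := (lp j).1; pose p j := (lp j).2.
have wl j : convex_weights U (l j) by have [] := lpP j.
have /choice[uj ujP] j : exists u, step_control U u /\ forall phi : 'rV[R]_m -> R,
    \int[mu]_(s in `]c j, c j + h]) phi (u s) =
    h * mean (V := R^o) phi (l j).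
  by have [u su uP] := chattering_mean (c j) U0 (wl j) h0; exists u.
have [u su uP] := glue_controls U0 c_nd (fun j => (ujP j).1) N.
have [y [yt yv yB]] := traj u su.
have ublock j : (j < N)%N -> forall phi : 'rV[R]_m -> R,
    \int[mu]_(s in `]c j, c j + h]) phi (u s) =
    h * mean (V := R^o) phi (l j).
  move=> jN phi; rewrite -(ujP j).2; apply: eq_Rintegral => s; rewrite inE /= -cS => sj.
  by rewrite (uP j).
have iL := integrable_along tT T0 (ltW k0) B0 L_lip su yB.
pose E j := `|y (c j) - x (c j)|.
pose q j := `|mean (f (c j) (x (c j))) (l j) + b j|.
pose Lam j := mean (V := R^o) (L (c j) (x (c j))) (l j).
pose r := k * ((1 + B) * h).
have r0 : 0 <= r by rewrite /r mulrA mulr_ge0.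
have block (psi : R -> 'rV[R]_n -> 'rV[R]_m -> R) j : (j < N)%N ->
    uniformly_lipschitz (W := R) T U k psi ->
    `|\int[mu]_(s in `]c j, c j.+1]) psi s (y s) (u s)
      - h * mean (V := R^o) (psi (c j) (x (c j))) (l j)| <= h * (k * E j + r).
  move=> jN psik; rewrite cS /r -mulrDr.
  have chT : c j + h <= T by rewrite -cS c_le.
  exact: (block_average (x (c j)) T0 (ltW k0) B0 psik su yB t0 (c_ge j) h0 chT (ublock j jN)).
have Estep j : (j < N)%N -> E j.+1 <= E j + h * k * E j + h * q j + h * r.
  move=> jN; pose D := y (c j.+1) - y (c j) - h *: mean (f (c j) (x (c j))) (l j).
  have Dle : `|D| <= h * (k * E j + r).
    apply/rV_norm_leP => [|i].
      by apply: mulr_ge0 => //; apply: addr_ge0 => //; apply: mulr_ge0; rewrite ?normr_ge0 ?ltW.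
    rewrite !mxE (density_incr yv) ?c_ge ?c_nd ?c_le//.
    have := block (fun s z a => f s z a 0 i) j jN (field_coord_lip i).
    by rewrite mean_coord.
  rewrite {1}/E.
  have -> : y (c j.+1) - x (c j.+1) = (y (c j) - x (c j)) + D
      + h *: (mean (f (c j) (x (c j))) (l j) + b j).
    rewrite scalerDr hb// /D; apply/rowP => i; rewrite !mxE; ring.
  apply: le_trans (ler_normD _ _) _; rewrite normrZ (ger0_norm h0) -/(q j).
  have := ler_normD (y (c j) - x (c j)) D; rewrite -/(E j); move: Dle.
  rewrite mulrDr mulrA; lra.
have q0 j : 0 <= q j by rewrite /q.
have E0 : E 0%N = 0 by rewrite /E /c mul0r addr0 yt subrr normr0.
have Ebound := discrete_gronwall h0 (ltW k0) r0 q0 E0 Estep.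
rewrite hN in Ebound.
pose W := \sum_(i < N) h * q i.
have Emax j : (j <= N)%N -> E j <= expR (k * S) * (W + S * r).
  move=> jN; apply: le_trans (Ebound j jN) _; rewrite ler_wpM2l ?expR_ge0// lerD//.
    rewrite /W -!(big_mkord xpredT (fun i => h * q i)) (big_cat_nat (n := j) _ jN)//=.
    by rewrite lerDl sumr_ge0// => i _; rewrite mulr_ge0.
  by rewrite ler_wpM2r// -hN ler_wpM2l// ler_nat.
pose G s := hamiltonian_conj U f L s (x s) (w s).
have G0 s : s \in `[t, T] -> (0 <= G s)%E.
  rewrite in_itv /= => /andP[ts sT]; apply: hamiltonian_conj_ge0 => a; apply: L_ge0.
  by rewrite in_itv /= sT (le_trans t0).
have in_block j s : (j < N)%N -> s \in `]c j, c j.+1] -> s \in `[t, T].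
  move=> jN; rewrite !in_itv /= => /andP[cs sc].
  by rewrite (le_trans (c_ge j) (ltW cs)) (le_trans sc)// c_le.
have splitc j : `]t, c j.+1]%classic = `]t, c j]%classic `|` `]c j, c j.+1]%classic.
  by rewrite -itv_bndbnd_setU ?bnd_simp// c_nd.
have disjc j : [disjoint `]t, c j]%classic & `]c j, c j.+1]%classic].
  apply/disj_setPLR => s /=; rewrite !in_itv /= => /andP[_ sc] /andP[].
  by rewrite ltNge sc.
have c00 : c 0%N = t by rewrite /c mul0r addr0.
have below j : (j <= N)%N -> ((\sum_(i < j) h * (A * q i + Lam i - 4 * e))%:E <=
    \int[mu]_(s in `]t, c j]) G s)%E.
  have inT i s : (i <= N)%N -> s \in `]t, c i] -> s \in `[t, T].
    move=> iN; rewrite !in_itv /= => /andP[ts sc].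
    by rewrite (ltW ts) (le_trans sc)// c_le.
  elim: j => [_|j IH jN].
    by rewrite big_ord0; apply: integral_ge0 => s /(inT _ _ (leq0n N))/G0.
  have := @ge0_integral_setU_lower _ _ _ mu _ _ G (disjc j).
  rewrite -splitc => /(_ (fun s sj => G0 s (inT _ _ jN sj))).
  apply: le_trans.
  rewrite big_ord_recr /= EFinD leeD ?IH 1?ltnW//.
  have [ipv Ipv] := density_dot (p j) xv (c_ge j) (c_nd _ _ (leqnSn j)) (c_le _ jN).
  pose K := A * q j + Lam j - 4 * e - dot (p j) (b j).
  have iK : mu.-integrable `]c j, c j.+1] (EFin \o fun=> K).
    by apply: (@integrable_cst_itv _ _ (c j) (c j.+1)); exact: subset_itv_oc_cc.
  (* As b j is the mean of - v, the linear term integrates to 0. *)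
  have -> : h * (A * q j + Lam j - 4 * e) =
      \int[mu]_(s in `]c j, c j.+1]) (K - dot (p j) (v s)).
    have hE : c j.+1 - c j = h by rewrite cS addrAC subrr add0r.
    rewrite RintegralB// Ipv Rintegral_cst_itv ?c_nd// hE.
    have -> : x (c j.+1) - x (c j) = - (h *: b j) by rewrite hb// opprB.
    by rewrite dotNr dotZr /K; ring.
  apply: Rintegral_le_lower; first by apply: (integrableB _ iK ipv).
    by move=> s /(in_block _ _ jN)/G0.
  apply: aeS wv => s ws sj; rewrite /G ws ?(in_block j)//.
  have := (lpP j).2 jN s (- v s) sj; apply: le_trans.
  rewrite lee_fin dotDr !dotNr /K -/(p j) -/(l j) -/(q j) -/(Lam j).
  by rewrite le_eqVlt; apply/orP; left; apply/eqP; ring.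
have above j : (j <= N)%N ->
    \int[mu]_(s in `]t, c j]) L s (y s) (u s) <=
    \sum_(i < j) (h * Lam i + h * (k * E i + r)).
  elim: j => [_|j IH jN]; first by rewrite big_ord0 c00 set_itvoc0 Rintegral_set0.
  rewrite splitc Rintegral_setU//; last first.
    rewrite -splitc; apply: integrableS iL => // s; rewrite /= !in_itv /= => /andP[ts sc].
    by rewrite (ltW ts) (le_trans sc)// c_le.
  rewrite big_ord_recr /= lerD ?IH 1?ltnW//.
  have := block L j jN L_lip; rewrite -/(Lam j) ler_norml => /andP[_].
  by rewrite lerBlDl.
exists u, y; split => //.
have iLo : mu.-integrable `]t, T] (EFin \o fun s => L s (y s) (u s)).
  by apply: integrableS iL => //; exact: subset_itv_oc_cc.
rewrite -Rintegral_itv_obnd_cbnd//.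
have lowC : \sum_(i < N) h * (A * q i + Lam i - 4 * e) <= C.
  rewrite -lee_fin; apply: le_trans (below N (leqnn N)) _; rewrite cN.
  apply: le_trans HC.
  have Tset : `[t, T]%classic = [set t] `|` `]t, T]%classic by rewrite setU1itv// bnd_simp.
  have disjT : [disjoint [set t] & `]t, T]%classic].
    by apply/disj_setPLR => s /= ->; rewrite in_itv /= ltxx.
  have := @ge0_integral_setU_lower _ _ _ mu _ _ G disjT.
  by rewrite -Tset integral_set1 add0e => /(_ G0).
have upL := above N (leqnn N); rewrite cN in upL.
have sumLow : \sum_(i < N) h * (A * q i + Lam i - 4 * e) =
    A * W + \sum_(i < N) h * Lam i - 4 * S * e.
  under eq_bigr => i _ do rewrite mulrBr mulrDr (mulrCA h A).
  rewrite big_split big_split /= -mulr_sumr sumr_const card_ord -/W.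
  by rewrite -hN -mulr_natr; ring.
have sumUp : \sum_(i < N) (h * Lam i + h * (k * E i + r)) <=
    \sum_(i < N) h * Lam i + S * (k * (expR (k * S) * (W + S * r)) + r).
  rewrite big_split /= lerD2l.
  apply: (@le_trans _ _ (\sum_(i < N) h * (k * (expR (k * S) * (W + S * r)) + r))).
    apply: ler_sum => i _; rewrite ler_wpM2l// lerD2r ler_wpM2l ?(ltW k0)//.
    exact/Emax/ltnW.
  by rewrite sumr_const card_ord -mulr_natr mulrAC hN.
have gT : g (y T) <= g (x T) + k * (expR (k * S) * (W + S * r)).
  have := g_lip (y T) (x T); have := Emax N (leqnn N); rewrite /E cN => EN.
  rewrite ler_norml lerBlDl => /andP[_ /le_trans]; apply.
  by rewrite lerD2l ler_wpM2l// ltW.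
have rQ : S * r * (A + 1) = h * Q by rewrite /r /Q; ring.
have : (k * S + k) * (expR (k * S) * (W + S * r)) = A * (W + S * r) by rewrite /A mulrA.
move: hQ; rewrite -rQ => {}hQ.
rewrite sumLow in lowC.
move: (expR (k * S) * (W + S * r)) sumUp gT => X; move: upL lowC hQ.
move: (\sum_(i < N) h * Lam i) (\sum_(i < N) _) (Rintegral _ _ _) => X1 X2 X3.
clear; move: (g (y T)) (g (x T)) => g1 g2; clear -S; clearbody S A r W; nra.
Qed.


End NearOptimal.

(** * Relaxation *)

Section Relaxation.
Context (R : realType) (n m : nat) (T : R) (U : set 'rV[R]_m).
Context (f : R -> 'rV[R]_n -> 'rV[R]_m -> 'rV[R]_n).
Context (L : R -> 'rV[R]_n -> 'rV[R]_m -> R) (g : 'rV[R]_n -> R).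
Hypotheses (T_gt0 : 0 < T) (U_neq0 : U !=set0).
Hypothesis f_lip : lipschitz_tx T U f.
Hypothesis L_ge0 : forall t x a, t \in `[0, T] -> U a -> 0 <= L t x a.
Hypothesis L_lip : lipschitz_tx (W := R) T U L.
Hypothesis g_lip : lipschitz g.
Hypothesis B_compact : compact (feasible_set U f 0 0).

(** Both relaxed problems at once: w is - x' in the first and beta in the second,
    equal almost everywhere to - v. *)
Lemma value_function_le_relaxed (t : R) x v w : t \in `[0, T] ->
  density t T x v ->
  {ae mu, forall s, s \in `[t, T] -> w s = - v s} ->
  (value_function T U f L g (x t) t <=
   \int[mu]_(s in `[t, T]) hamiltonian_conj U f L s (x s) (w s)
   + (g (x T))%:E)%E.
Proof.
move=> t_in xv wv.
have [kf kf0 kfP] := lipschitz_tx_uniformly f_lip.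
have [kL kL0 kLP] := lipschitz_tx_uniformly L_lip.
have [kg [_ kgP]] := g_lip.
pose k := kf + kL + `|kg| + 1.
have k0 : 0 < k by rewrite ltr_wpDl// !addr_ge0.
have kf_le : kf <= k by rewrite /k -!addrA lerDl !addr_ge0.
have kL_le : kL <= k by rewrite /k -!addrA (addrCA kf) lerDl !addr_ge0.
have gk z z' : `|g z - g z'| <= k * `|z - z'|.
  apply: (kgP k _ (z, z')) => //; apply: (le_lt_trans (ler_norm kg)).
  by rewrite /k -[ltLHS]add0r -addrA ler_ltD ?addr_ge0// ltrDl.
have [M0 [_ MP]] := compact_bounded B_compact.
have fM a : U a -> `|f 0 0 a| <= `|M0| + 1.
  move=> Ua; rewrite -normrN; apply: MP; last by exists a.
  by rewrite (le_lt_trans (ler_norm M0))// ltrDl.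
have tT : 0 <= t <= T by move: t_in; rewrite in_itv.
have /andP[t0 tT'] := tT.
set I := (\int[_]_(s in _) _)%E.
have I0 : (0 <= I)%E.
  apply: integral_ge0 => s; rewrite /= in_itv /= => /andP[ts sT].
  apply: hamiltonian_conj_ge0 => a; apply: L_ge0.
  by rewrite in_itv /= sT (le_trans t0).
have [->|] := eqVneq I +oo%E; first by rewrite addye// leey.
rewrite -ltey => Ifin.
have IE : I = (fine I)%:E by rewrite fineK// ge0_fin_numE.
apply/lee_addgt0Pr => e e0.
have S0 : 0 < 4 * (T - t) + 1 by rewrite ltr_wpDl// mulr_ge0// subr_ge0.
have e'0 : 0 < e / (4 * (T - t) + 1) by rewrite divr_gt0.
have IC : (I <= (fine I)%:E)%E by rewrite -IE.
have [u [y [su yt yv iL cost]]] := near_optimal_control T_gt0 U_neq0 k0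
  (kfP k kf_le) (kLP k kL_le) gk L_ge0 fM tT xv wv IC e'0.
apply: (@le_trans _ _ (\int[mu]_(s in `[t, T]) (L s (y s) (u s))%:E
             + (g (y T))%:E)%E).
  apply: ereal_inf_lbound; exists u, y; split => //.
  - split=> [i|s _]; last exact: step_control_in su _.
    apply: measurable_funTS.
    by apply: (step_control_measurable (phi := fun _ a => a 0 i)) su _.
  - by exists (fun s => f s (y s) (u s)).
  - exact: density_is_derive yv.
have -> : (\int[mu]_(s in `[t, T]) (L s (y s) (u s))%:E)%E =
    (\int[mu]_(s in `[t, T]) L s (y s) (u s))%:E.
  by rewrite /Rintegral fineK//; apply: integrable_fin_num.
rewrite IE -!EFinD lee_fin; apply: le_trans cost _.
by rewrite mulrC divfK// gt_eqF.
Qed.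

(** Fenchel's inequality, integrated; the right-hand side may be a genuine lower
    integral. *)
Lemma relaxed_cost_le_cost (t : R) x b u : t \in `[0, T] ->
  (forall s, s \in `[0, T] -> U (u s)) ->
  {ae mu, forall s, s \in `[t, T] -> b s = - f s (x s) (u s)} ->
  (\int[mu]_(s in `[t, T]) hamiltonian_conj U f L s (x s) (b s)
   <= \int[mu]_(s in `[t, T]) (L s (x s) (u s))%:E)%E.
Proof.
rewrite in_itv /= => /andP[t0 tT] Uu bf.
have inT s : s \in `[t, T] -> s \in `[0, T].
  by rewrite !in_itv /= => /andP[ts ->]; rewrite (le_trans t0).
apply: ge0_ae_le_integral_lower.
- by move=> s /inT sT; apply: hamiltonian_conj_ge0 => a; exact: L_ge0.
- by move=> s /inT sT; rewrite lee_fin L_ge0//; exact: Uu.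
- by apply: aeS bf => s bs st; rewrite bs//; apply: hamiltonian_conj_le_cost; apply/Uu/inT.
Qed.

End Relaxation.

Unset Implicit Arguments.

Theorem theorem1 (R : realType) (n m : nat) (T : R) (U : set 'rV[R]_m)
    (f : R -> 'rV[R]_n -> 'rV[R]_m -> 'rV[R]_n)
    (L : R -> 'rV[R]_n -> 'rV[R]_m -> R) (g : 'rV[R]_n -> R)
    (T_gt0 : 0 < T) (U_neq0 : U !=set0) (U_compact : compact U)
    (f_lip : lipschitz_tx T U f)
    (L_ge0 : forall (t : R) x a, t \in `[0, T] -> U a -> 0 <= L t x a)
    (L_lip : lipschitz_tx (W := R) T U L)
    (g_lip : lipschitz g)
    (g_bounded : exists M : R, forall x, `|g x| <= M)
    (B_compact : forall x (t : R), t \in `[0, T] -> compact (feasible_set U f x t))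
    (x0 : 'rV[R]_n) (t : R) (t_in : t \in `[0, T]) :
  value_function T U f L g x0 t =
    ereal_inf [set J : \bar R | exists x : R -> 'rV[R]_n,
      [/\ abs_continuous_curve t T x, x t = x0
        & J = (\int[@lebesgue_measure R]_(s in `[t, T])
                 hamiltonian_conj U f L s (x s) (- derive1 x s)
               + (g (x T))%:E)%E]]
  /\
  value_function T U f L g x0 t =
    ereal_inf [set J : \bar R | exists x beta : R -> 'rV[R]_n,
      [/\ abs_continuous_curve t T x, measurable_curve `[t, T] beta, x t = x0,
          {ae @lebesgue_measure R, forall s, s \in `[t, T] ->
             is_derive s 1 x (- beta s)
             /\ convex_hull (feasible_set U f (x s) s) (beta s)}
        & J = (\int[@lebesgue_measure R]_(s in `[t, T])
                 hamiltonian_conj U f L s (x s) (beta s)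
               + (g (x T))%:E)%E]].
Proof.
have B0 : compact (feasible_set U f 0 0).
  by apply: B_compact; rewrite in_itv /= lexx ltW.
have relaxed := value_function_le_relaxed T_gt0 U_neq0 f_lip L_ge0 L_lip g_lip B0 t_in.
split; apply/le_anti/andP; split.
- apply: le_ereal_inf_tmp => _ [x [[v xv] <- ->]]; apply: (relaxed x v) => //.
  apply: aeS (density_is_derive xv) => s xs /xs [_ dx].
  by rewrite derive1E dx.
- apply: le_ereal_inf_tmp => _ [u [x [[mu Uu] xac xt xs ->]]].
  apply: (@le_trans _ _ (\int[@lebesgue_measure R]_(s in `[t, T])
      hamiltonian_conj U f L s (x s) (- derive1 x s) + (g (x T))%:E)%E).
    by apply: ereal_inf_lbound; exists x.
  apply: leeD => //; apply: relaxed_cost_le_cost => //.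
  by apply: aeS xs => s xs /xs [_ dx]; rewrite derive1E dx.
- apply: le_ereal_inf_tmp => _ [x [beta [[v xv] mbeta <- xs ->]]]; apply: (relaxed x v) => //.
  apply: aeS (aeI xs (density_is_derive xv)) => s [bs vs] st.
  have [[_ dxb] _] := bs st; have [_ dxv] := vs st.
  by rewrite -dxv dxb opprK.
- apply: le_ereal_inf_tmp => _ [u [x [[mu Uu] xac xt xs ->]]].
  have [v xv] := xac.
  have vf : {ae @lebesgue_measure R, forall s, s \in `[t, T] ->
      v s = f s (x s) (u s) /\ is_derive s 1 x (v s)}.
    apply: aeS (aeI xs (density_is_derive xv)) => s [fs vs] st; split; last exact: vs.
    by have [_ <-] := fs st; have [_ <-] := vs st.
  apply: (@le_trans _ _ (\int[@lebesgue_measure R]_(s in `[t, T])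
      hamiltonian_conj U f L s (x s) (- v s) + (g (x T))%:E)%E).
    apply: ereal_inf_lbound; exists x, (fun s => - v s); split => //.
      move=> i; have [/measurable_int mv _] := xv i.
      rewrite (_ : (fun s => _) = (fun s => - v s 0 i)); last first.
        by apply/funext => s; rewrite mxE.
      by apply: measurableT_comp => //; exact/measurable_EFinP.
    apply: aeS vf => s vs st; have [vE dx] := vs st; rewrite opprK; split => //.
    exists 1%N, (fun=> 1), (fun=> - v s); split => //.
    + by rewrite big_ord1.
    + move=> _; exists (u s); last by rewrite vE.
      move: t_in st; rewrite !in_itv /= => /andP[t0 _] /andP[ts sT].
      by apply: Uu; rewrite in_itv /= sT (le_trans t0).
    + by rewrite big_ord1 scale1r.
  apply: leeD => //; apply: relaxed_cost_le_cost => //.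
  by apply: aeS vf => s vs /vs [-> _].
Qed.
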